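(* Let $b\ge 2$ be a natural number, identified with $\{0,1,\dots,b-1\}$. Let $\Omega$ be a standard Borel space and let $G$ be a symmetric Borel graph on $\Omega$ (as defined in the context). Let $\mathbf R$ be a Borel local rule on $G$. Assume that the graph $\mathrm{Rel}(G)$ is of uniformly subexponential growth, and let $\Delta$ be the maximal degree of a vertex in $\mathrm{Rel}(G)$. For $x\in\Omega$ let $p(x):=1-\frac{|\mathbf R(x)|}{b^{\deg(x)}}$, where $\deg(x)=|N(x)|$. If $p(x)<\frac{1}{e\Delta}$ for all $x\in\Omega$, then there exists a Borel function $f\colon \Omega\to b$ which satisfies $\mathbf R$.
   Context: A Borel arrow on a standard Borel space $\Omega$ is a pair $(U,\gamma)$ with $U\subseteq\Omega$ Borel and $\gamma\colon U\to\Omega$ a Borel isomorphism onto its image. A Borel graph on $\Omega$ is an oriented graph $G$ with vertex set $\Omega$ and edge set $\{(x,y): \exists i\ (x\in U_i,\ \gamma_i(x)=y)\}$ for some countable sequence $S=((U_1,\gamma_1),(U_2,\gamma_2),\dots)$ of Borel arrows (self-loops allowed, at most one per vertex); it is symmetric if $(x,y)\in E(G)\iff(y,x)\in E(G)$. The neighbourhood of $x$ is $N(x)=\{y:(x,y)\in E(G)\}$; its degree is $|N(x)|$ (a self-loop counts once). $N(x)$ is well-ordered by: $y<z$ iff the least $i$ with $x\in U_i,\gamma_i(x)=y$ is smaller than the least $j$ with $x\in U_j,\gamma_j(x)=z$. A local rule assigns to each $x$ a set $\mathbf R(x)$ of functions $N(x)\to b$. Letting $\iota_x\colon |N(x)|\to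 N(x)$ be the order isomorphism and $\mathbb S$ the set of finite $b$-valued sequences, put $\mathbf R'(x)=\{g\circ\iota_x: g\in\mathbf R(x)\}\subseteq\mathbb S$; $\mathbf R$ is Borel if $\{x:\mathbf R'(x)=A\}$ is Borel for every $A\subseteq\mathbb S$. A function $f\colon\Omega\to b$ satisfies $\mathbf R$ if $f|_{N(x)}\in\mathbf R(x)$ for all $x$. $\mathrm{Rel}(G)$ is the graph on $\Omega$ with an edge between $x$ and $y$ (possibly $x=y$) iff $N(x)\cap N(y)\neq\emptyset$; degrees count a self-loop once. A graph is of uniformly subexponential growth if for every $\varepsilon>0$ there is $r$ such that for all $R>r$ and all vertices $v$, the set of vertices at graph distance at most $R$ from $v$ has fewer than $(1+\varepsilon)^R$ elements. *)

(* Defs.v *)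
From HB Require Import structures.
From mathcomp Require Import all_boot all_order all_algebra.
From mathcomp Require Import boolp classical_sets functions cardinality reals.
From mathcomp Require Import measurable_structure measurable_function sequences exp.
Set Implicit Arguments. Unset Strict Implicit. Unset Printing Implicit Defensive.
Import Order.TTheory GRing.Theory Num.Theory.
Local Open Scope classical_set_scope.
Local Open Scope ring_scope.
Local Open Scope card_scope.

(* cardinality of a (finite) set: the n with A #= `I_n (0 if A is infinite) *)
Definition ncard {T} (A : set T) : nat := xget 0%N [set n | A #= `I_n].

Definition is_metric {R : realType} {T} (dist : T -> T -> R) :=
  [/\ forall x y, 0 <= dist x y,
      forall x y, dist x y = 0 <-> x = y,
      forall x y, dist x y = dist y x &
      forall x y z, dist x z <= dist x y + dist y z].

Definition metric_open {R : realType} {T} (dist : T -> T -> R) (U : set T) :=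
  forall x, U x -> exists2 e : R, 0 < e & [set y | dist x y < e] `<=` U.

Definition metric_complete {R : realType} {T} (dist : T -> T -> R) :=
  forall u : nat -> T,
    (forall e : R, 0 < e -> exists N, forall m n, (N <= m)%N -> (N <= n)%N ->
       dist (u m) (u n) < e) ->
    exists l, forall e : R, 0 < e -> exists N, forall n, (N <= n)%N -> dist (u n) l < e.

Definition metric_separable {R : realType} {T} (dist : T -> T -> R) :=
  exists D : set T, countable D /\
    forall x (e : R), 0 < e -> exists2 y, D y & dist x y < e.

Definition standard_borel (R : realType) d (Omega : measurableType d) :=
  exists dist : Omega -> Omega -> R,
    [/\ is_metric dist, metric_complete dist, metric_separable dist &
        (@measurable d Omega) = <<s metric_open dist >>].

(** Borel arrows and Borel graphs.  The countable sequence of arrows is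
    indexed by nat; arrow i is (U i, gam i), gam i only matters on U i. *)
Definition borel_arrow d (Omega : measurableType d) (U : set Omega)
    (gam : Omega -> Omega) :=
  [/\ measurable U, set_inj U gam, measurable_fun U gam &
      forall A, A `<=` U -> measurable A -> measurable (gam @` A)].

Definition borel_arrows d (Omega : measurableType d) (U : nat -> set Omega)
    (gam : nat -> Omega -> Omega) := forall i, borel_arrow (U i) (gam i).

Section Graph.
Context {Omega : Type} (U : nat -> set Omega) (gam : nat -> Omega -> Omega).

Definition edge (x y : Omega) : Prop := exists i, U i x /\ gam i x = y.

Definition symmetric_graph := forall x y, edge x y <-> edge y x.

Definition nbhd (x : Omega) : set Omega := [set y | edge x y].
Definition deg (x : Omega) : nat := ncard (nbhd x).

(* well-order on N(x): y < z iff the least index of y is smaller than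
   the least index of z *)
Definition nlt (x y z : Omega) : Prop :=
  exists i, (U i x /\ gam i x = y) /\
            forall j, (j <= i)%N -> ~ (U j x /\ gam j x = z).

(* position of y in the ordered neighbourhood, i.e. iota_x^{-1} y *)
Definition nrank (x y : Omega) : nat := ncard [set z | edge x z /\ nlt x z y].

(* R'(x): the set of b-valued sequences g o iota_x for g in R(x) *)
Definition rule_seq (b : nat) (Rl : forall x, set ({y : Omega | edge x y} -> 'I_b))
    (x : Omega) : set (seq 'I_b) :=
  [set s | exists2 g, Rl x g &
     size s = deg x /\
     forall y (hy : edge x y), nth (g (exist _ y hy)) s (nrank x y) = g (exist _ y hy)].

Definition rel_edge (x y : Omega) : Prop := exists z, edge x z /\ edge y z.
Definition rel_nbhd (x : Omega) : set Omega := [set y | rel_edge x y].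

Fixpoint rel_walk (k : nat) (v w : Omega) : Prop :=
  match k with
  | 0%N => v = w
  | k'.+1 => exists u, rel_edge v u /\ rel_walk k' u w
  end.
Definition rel_ball (v : Omega) (r : nat) : set Omega :=
  [set w | exists2 k, (k <= r)%N & rel_walk k v w].

Definition unif_subexp_growth (R : realType) : Prop :=
  forall eps : R, 0 < eps -> exists r : nat, forall Rd : nat, (r < Rd)%N ->
    forall v, exists2 n : nat, rel_ball v Rd #= `I_n & n%:R < (1 + eps) ^+ Rd.

End Graph.

Definition borel_local_rule d (Omega : measurableType d) (U : nat -> set Omega)
    (gam : nat -> Omega -> Omega) (b : nat)
    (Rl : forall x, set ({y : Omega | edge U gam x y} -> 'I_b)) :=
  forall A : set (seq 'I_b), measurable [set x | rule_seq Rl x = A].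

(* Main.v *)
(** Moser-Tardos resampling with shared random bits.  Colour [Omega] by finitely
    many colours so that points of a large ball of [Rel(G)] have distinct colours,
    and let the [j]-th value of a point depend only on [j] and on its colour, through
    a finite random table.  Suppose that for every table some clause is eventually
    resampled [k] times, and stop when this first happens.  Since all clauses of the
    ball around such a clause have been resampled at most [k] times, subexponential
    growth provides a radius at which the resamplings in the boundary sphere are a
    tiny fraction of those inside.  The execution inside this ball is then recorded
    by a log (a heap of clauses, organised in levels).  A fixed log with [s] inner
    resamplings has probability at most [p^s], the logs weighted by [(1/(e Delta))^size]
    have bounded total mass, and only finitely many local situations occur, so that
    the fraction of such tables tends to 0 as [k] grows.  Hence some table resamples
    every clause fewer than [k] times, and the process converges pointwise to a Borel
    solution. *)

Require Import Defs.
From HB Require Import structures.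
From mathcomp Require Import all_boot all_order all_algebra.
Set Implicit Arguments. Unset Strict Implicit. Unset Printing Implicit Defensive.
Import Order.TTheory GRing.Theory Num.Theory.

(** * Logs over a finite set of clauses *)

Definition depends_on (T K : finType) (D : {set T}) (A : {set {ffun T -> K}}) :=
  forall f g : {ffun T -> K}, {in D, f =1 g} -> (f \in A) = (g \in A).

(* Exchanging the coordinates outside [D] of two functions is an involution that
   turns [(A :&: B) x all] into [A x B]. *)
Lemma card_indep (T K : finType) (D : {set T}) (A B : {set {ffun T -> K}}) :
  depends_on D A -> depends_on (~: D) B ->
  #|A :&: B| * #|{: {ffun T -> K}}| = #|A| * #|B|.
Proof.
move=> dA dB.
pose splice (f g : {ffun T -> K}) : {ffun T -> K} := [ffun t => if t \in D then f t else g t].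
pose swap (u : {ffun T -> K} * {ffun T -> K}) := (splice u.1 u.2, splice u.2 u.1).
have swapK : involutive swap.
  case=> f g; rewrite /swap /=; congr (_, _).
    by apply/ffunP => t; rewrite !ffunE /=; case: (t \in D).
  by apply/ffunP => t; rewrite !ffunE /=; case: (t \in D).
rewrite -(cardsT {ffun T -> K}) -!cardsX -(card_preimset (setX A B) (inv_inj swapK)).
apply: eq_card => -[f g]; rewrite !inE /= andbT; congr andb.
- by apply: dA => t tD; rewrite ffunE tD.
- by apply: dB => t; rewrite inE ffunE => /negPf ->.
Qed.

(** Exchanging [g] with the coordinates of [f] along [h] is an involution, so an event keeps its
    density when read through an injective renaming of coordinates. *)
Lemma card_pullback (A T K : finType) (h : A -> T) (B : {set {ffun A -> K}}) :
  injective h ->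
  #|[set f : {ffun T -> K} | [ffun a => f (h a)] \in B]| * #|{: {ffun A -> K}}|
  = #|B| * #|{: {ffun T -> K}}|.
Proof.
move=> hI.
pose upd (f : {ffun T -> K}) (g : {ffun A -> K}) : {ffun T -> K} :=
  [ffun t => if [pick a | h a == t] is Some a then g a else f t].
pose pull (f : {ffun T -> K}) : {ffun A -> K} := [ffun a => f (h a)].
have updh f g a : upd f g (h a) = g a.
  by rewrite ffunE; case: pickP => [c /eqP/hI -> //|/(_ a)]; rewrite eqxx.
pose swap (u : {ffun T -> K} * {ffun A -> K}) := (upd u.1 u.2, pull u.1).
have swapK : involutive swap.
  case=> f g; rewrite /swap /=; congr (_, _); apply/ffunP => t; last by rewrite ffunE updh.
  rewrite ffunE /=; case: pickP => [a /eqP <-|no]; first by rewrite ffunE.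
  by rewrite ffunE; case: pickP => // a; rewrite no.
rewrite [RHS]mulnC -(cardsT {ffun T -> K}) -(cardsT {ffun A -> K}) -!cardsX.
rewrite -(card_preimset (setX setT B) (inv_inj swapK)).
by apply: eq_card => -[f g]; rewrite !inE /= andbT.
Qed.

Local Open Scope ring_scope.

(** Product rule for independent events: by disjointness the tail depends only on coordinates
    outside [D i], so [card_indep] splits off one factor [p] at a time. *)
Lemma card_all_indep (R : realFieldType) (T K : finType) (I : eqType)
    (es : seq I) (D : I -> {set T}) (A : I -> {set {ffun T -> K}}) (p : R) :
  0 <= p -> uniq es -> {in es, forall i, depends_on (D i) (A i)} ->
  {in es &, forall i j, i != j -> [disjoint D i & D j]} ->
  {in es, forall i, #|A i|%:R <= p * #|{: {ffun T -> K}}|%:R} ->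
  #|[set f | all (fun i => f \in A i) es]|%:R <= p ^+ size es * #|{: {ffun T -> K}}|%:R.
Proof.
move=> p0; elim: es => [|i es IH] /=.
  by rewrite expr0 mul1r ler_nat max_card.
move=> /andP[ies ues] dep dis dens.
have sub j : j \in es -> j \in i :: es by rewrite inE orbC => ->.
have {}IH : #|[set f | all (fun i => f \in A i) es]|%:R
    <= p ^+ size es * #|{: {ffun T -> K}}|%:R.
  apply: IH => //.
  - by move=> j /sub; apply: dep.
  - by move=> j k /sub js /sub ks; apply: dis.
  - by move=> j /sub; apply: dens.
set B := [set f | all _ es] in IH *.
have dB : depends_on (~: D i) B.
  move=> f g fg; rewrite !inE; apply: eq_in_all => j js.
  apply: dep; first exact: sub.
  move=> t tj; apply: fg; rewrite inE.
  have := dis j i (sub _ js) (mem_head _ _).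
  case: eqP => [ji|_ /(_ isT)]; first by rewrite -ji js in ies.
  by move/disjointFr => ->.
have := card_indep (dep i (mem_head _ _)) dB.
have -> : A i :&: B = [set f | (f \in A i) && all (fun j => f \in A j) es].
  by apply/setP => f; rewrite !inE.
set X := #|[set f | _ && _]|; set F := #|{: {ffun T -> K}}|.
move=> E; have [F0|Fpos] := posnP F.
  have : (X <= F)%N by apply: max_card.
  by rewrite F0 leqn0 => /eqP ->; rewrite mulr0.
have F0 : 0 < F%:R :> R by rewrite ltr0n.
rewrite -(ler_pM2r F0) -natrM E natrM exprS -!mulrA.
apply: le_trans (ler_pM _ _ (dens i (mem_head _ _)) IH) _ => //.
by rewrite -/F -!mulrA [F%:R * _]mulrCA.
Qed.

Section Logs.
Variables (V : finType) (vars : V -> {set V}).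

(** A clause with a nonempty scope is adjacent to itself, so it may recur at consecutive levels;
    this matches the self-loops counted in the degree of [Rel(G)]. *)
Definition adj (c c' : V) := vars c :&: vars c' != set0.
Definition adj_set (J : {set V}) := [set c' | [exists c in J, adj c c']].

(* Levels of an execution log: every clause of a level has to be adjacent to
   some clause of the preceding level, so that the number of logs is governed
   by the branching [Delta]. *)
Fixpoint chained (A : {set V}) (L : seq {set V}) :=
  if L is J :: L' then (J \subset A) && chained (adj_set J) L' else true.

(** Fixing the number of levels gives a finite list; empty levels are allowed, so shorter logs are
    covered by padding. *)
Fixpoint logs M (A : {set V}) : seq (seq {set V}) :=
  if M is M'.+1 then
    flatten [seq [seq J :: L | L <- logs M' (adj_set J)] | J <- enum (powerset A)]
  else [:: [::]].

Lemma mem_logs M A L : size L = M -> chained A L -> L \in logs M A.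
Proof.
elim: M A L => [|M IH] A [|J L] //= [sL] /andP[JA cL].
apply/flatten_mapP; exists J; first by rewrite mem_enum powersetE.
by apply: map_f; apply: IH.
Qed.

Lemma card_adj_set Delta J : (forall c, #|[set c' | adj c c']| <= Delta)%N ->
  (#|adj_set J| <= Delta * #|J|)%N.
Proof.
move=> hD; have -> : adj_set J = \bigcup_(c in J) [set c' | adj c c'].
  apply/setP => c'; rewrite inE; apply/existsP/bigcupP.
    by case=> c /andP[cJ cc']; exists c; rewrite ?inE.
  by case=> c cJ; rewrite inE => cc'; exists c; rewrite cJ.
apply: (@leq_trans (\sum_(c in J) #|[set c' | adj c c']|)).
  elim/big_ind2: _ => // [|m1 A1 m2 A2 h1 h2]; first by rewrite cards0.
  by apply: leq_trans (leq_card_setU _ _) _; apply: leq_add.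
apply: (@leq_trans (\sum_(c in J) Delta)); first exact: leq_sum.
by rewrite sum_nat_const mulnC.
Qed.

(** Binomial theorem: expand the product with factor [1 + x] at points of [A] and [1] elsewhere. *)
Lemma sum_subset_expr (R : comRingType) (A : {set V}) (x : R) :
  \sum_(J in powerset A) x ^+ #|J| = (1 + x) ^+ #|A|.
Proof.
transitivity (\prod_i ((if i \in A then x else 0) + 1)); last first.
  rewrite -prodr_const [RHS]big_mkcond; apply: eq_bigr => i _.
  by case: ifP; rewrite ?add0r // addrC.
rewrite bigA_distr big_mkcond; apply: eq_bigr => J _.
rewrite powersetE; case: ifPn => [/subsetP JA|/subsetPn[i iJ iA]].
  rewrite -prodr_const big_mkcond; apply: eq_bigr => i _.
  by case: ifP => // /JA ->.
by rewrite (bigD1 i) //= iJ (negPf iA) mul0r.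
Qed.

(* The weight bound [q (1 + x)^Delta <= x] is the usual cluster-expansion
   condition; it is what makes the induction close. *)
Lemma sum_logs (R : realFieldType) (q x : R) Delta M A : 0 <= q -> 0 <= x ->
  q * (1 + x) ^+ Delta <= x -> (forall c, #|[set c' | adj c c']| <= Delta)%N ->
  \sum_(L <- logs M A) q ^+ (\sum_(J <- L) #|J|) <= (1 + x) ^+ #|A|.
Proof.
move=> q0 x0 qx hD; elim: M A => [|M IH] A /=.
  by rewrite big_seq1 big_nil expr0 exprn_ege1 // lerDl.
rewrite big_flatten big_map big_enum -sum_subset_expr /=; apply: ler_sum => J _.
rewrite big_map; under eq_bigr do rewrite big_cons exprD.
rewrite -mulr_sumr; apply: le_trans (ler_wpM2l (exprn_ge0 _ q0) (IH _)) _.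
apply: le_trans (_ : (q * (1 + x) ^+ Delta) ^+ #|J| <= _).
  rewrite exprMn -exprM ler_wpM2l ?exprn_ge0 //.
  by rewrite ler_weXn2l ?lerDl // card_adj_set.
by apply: lerXn2r; rewrite ?nnegrE ?mulr_ge0 ?exprn_ge0 ?addr_ge0.
Qed.
End Logs.

Lemma card_has_le (R : numDomainType) (T : finType) (I : Type) (P : I -> T -> bool) (s : seq I) :
  #|[set f | has (P^~ f) s]|%:R <= \sum_(i <- s) #|[set f | P i f]|%:R :> R.
Proof.
elim: s => [|i s IH]; rewrite ?big_nil ?big_cons /=.
  by rewrite eq_card0 // => f; rewrite inE.
apply: le_trans (_ : #|[set f | P i f] :|: [set f | has (P^~ f) s]|%:R <= _).
  by rewrite ler_nat subset_leq_card //; apply/subsetP => f; rewrite !inE.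
apply: le_trans (lerD (lexx _) IH).
by rewrite -natrD ler_nat leq_card_setU.
Qed.

(** * Probability of a log *)

Section LocalBound.
Variables (R : realFieldType) (V K : finType) (m k N : nat).
Variables (P : {set V}) (vars : V -> {set V}) (bad : V -> {set {ffun V -> K}}).
Local Notation cell := (V * 'I_m.+1)%type.
Local Notation table := {ffun cell -> K}.

(** How often [y] is resampled below level [l], hence the index of the table entry that holds the
    value of [y] seen by level [l]. *)
Definition reads (L : seq {set V}) (l : nat) (y : V) : nat :=
  (\sum_(0 <= i < l) #|[set c in nth set0 L i | y \in vars c]|)%N.

Definition assignment (rnd : table) L l : {ffun V -> K} :=
  [ffun y => rnd (y, inord (reads L l y))].

Definition inner_events (L : seq {set V}) : seq (nat * V) :=
  [seq (l, c) | l <- iota 0 (size L), c <- enum (nth set0 L l :&: P)].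

(** Only events in [P] are tested: a variable of an outer clause may also be resampled by clauses
    invisible to the log, so its index is unreliable. *)
Definition consistent (rnd : table) L :=
  all (fun lc => assignment rnd L lc.1 \in bad lc.2) (inner_events L).

Definition inner_size (L : seq {set V}) : nat := (\sum_(J <- L) #|J :&: P|)%N.
Definition outer_size (L : seq {set V}) : nat := (\sum_(J <- L) #|J :\: P|)%N.

Definition independent (J : {set V}) :=
  [forall c in J, forall c' in J, adj vars c c' ==> (c == c')].

(** The bound [m] keeps [inord] faithful in [assignment]. The last two conditions describe a ball
    whose centre was resampled [k] times and whose boundary carries at most a fraction [1/N] of the
    inner resamplings. *)
Definition admissible (L : seq {set V}) :=
  [&& all independent L, [forall y, reads L (size L) y <= m]%N,
      (k <= inner_size L)%N & (N * outer_size L <= inner_size L)%N].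

Lemma leq_reads L l l' y : (l <= l')%N -> (reads L l y <= reads L l' y)%N.
Proof.
by move=> ll'; rewrite /reads (@big_cat_nat _ _ _ l _ _ _ _ _ ll') //= leq_addr.
Qed.

Lemma ltn_reads L l l' y c : (l < l')%N -> c \in nth set0 L l -> y \in vars c ->
  (reads L l y < reads L l' y)%N.
Proof.
move=> ll' cl yc; apply: leq_trans (leq_reads _ _ ll').
rewrite /reads big_nat_recr //= -[X in (X < _)%N]addn0 ltn_add2l card_gt0.
by apply/set0Pn; exists c; rewrite inE cl.
Qed.

Lemma size_inner_events L : size (inner_events L) = inner_size L.
Proof.
rewrite size_allpairs_dep sumnE big_map /inner_size (big_nth set0) /index_iota subn0.
by apply: eq_bigr => l _; rewrite cardE.
Qed.

Lemma mem_inner_events L l c :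
  ((l, c) \in inner_events L) = [&& (l < size L)%N, c \in nth set0 L l & c \in P].
Proof.
apply/allpairsPdep/and3P => [[l' [c' [hl hc [-> ->]]]]|[hl hc cP]].
  by move: hl hc; rewrite mem_iota mem_enum inE => /andP[_ ->] /andP[].
by exists l, c; rewrite mem_iota mem_enum inE hc cP.
Qed.

Hypothesis K_gt0 : (0 < #|K|)%N.
Hypothesis bad_vars : forall c, depends_on (vars c) (bad c).
Variable p : R.
Hypothesis p_ge0 : 0 <= p.
Hypothesis bad_p : forall c, #|bad c|%:R <= p * #|{: {ffun V -> K}}|%:R.

(** Distinct inner events read disjoint sets of cells: scopes within a level are disjoint, and the
    index of a variable strictly increases past each level that uses it. So the events are
    independent, each of density at most [p]. *)
Lemma card_consistent L : all independent L ->
  [forall y, reads L (size L) y <= m]%N ->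
  #|[set rnd | consistent rnd L]|%:R <= p ^+ inner_size L * #|{: table}|%:R.
Proof.
move=> /allP ind /forallP hm.
pose cells (lc : nat * V) : {set cell} :=
  [set (y, inord (reads L lc.1 y)) | y in vars lc.2].
pose A (lc : nat * V) := [set rnd | assignment rnd L lc.1 \in bad lc.2].
have -> : [set rnd | consistent rnd L] =
    [set rnd | all (fun lc => rnd \in A lc) (inner_events L)].
  by apply/setP => rnd; rewrite !inE; apply: eq_all => lc; rewrite inE.
rewrite -size_inner_events; apply: (@card_all_indep _ _ _ _ _ cells) => //.
- apply: allpairs_uniq_dep => [|l _|]; rewrite ?iota_uniq ?enum_uniq //.
  by move=> [l c] [l' c'] _ _ [-> ->].
- move=> [l c] _ f g fg; rewrite !inE; apply: bad_vars => y yc; rewrite !ffunE.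
  by apply: fg; apply/imsetP; exists y.
- move=> [l c] [l' c']; rewrite !mem_inner_events => /and3P[hl cl _] /and3P[hl' cl' _] ne.
  rewrite -setI_eq0; apply: contraNT ne => /set0Pn[z /setIP[]].
  case/imsetP => y /= yc ->; case/imsetP => y' /= yc' [yy].
  rewrite -{}yy in yc' *.
  have ltm i : (i < size L)%N -> (reads L i y < m.+1)%N.
    by move=> hi; rewrite ltnS; apply: leq_trans (hm y); apply: leq_reads; apply: ltnW.
  move=> /(congr1 val); rewrite /= !inordK ?ltm // => E.
  have ll' : l = l'.
    by case: (ltngtP l l') => // h;
      [have := ltn_reads h cl yc | have := ltn_reads h cl' yc']; rewrite E ltnn.
  subst l'; rewrite xpair_eqE eqxx /=.
  have /ind/forall_inP/(_ c cl)/forall_inP/(_ c' cl')/implyP := mem_nth set0 hl.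
  by apply; apply/set0Pn; exists y; rewrite inE yc yc'.
(* [h] picks one cell per variable at level [l], so the density of [bad c] carries over from
   assignments to tables. *)
- move=> [l c] _ /=; pose h y : cell := (y, inord (reads L l y)).
  have hI : injective h by move=> y y' [].
  have E := card_pullback (bad c) hI.
  have F0 : 0 < #|{: {ffun V -> K}}|%:R :> R by rewrite ltr0n card_ffun expn_gt0 K_gt0.
  rewrite -(ler_pM2r F0) -natrM; move: (E) => {E}->.
  by rewrite natrM mulrAC ler_wpM2r.
Qed.

Variables (q x rho : R) (Delta : nat).
Hypotheses (q_ge0 : 0 <= q) (x_ge0 : 0 <= x) (rho_ge0 : 0 <= rho) (rho_le1 : rho <= 1).
Hypothesis q_x : q * (1 + x) ^+ Delta <= x.
Hypothesis adj_Delta : forall c, (#|[set c' | adj vars c c']| <= Delta)%N.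
Hypothesis p_q : forall a a', (N * a' <= a)%N -> p ^+ a <= rho ^+ a * q ^+ (a + a').

(** Union bound over logs. Outer events contribute no factor [p]; by [p_q] the gap between [p] and
    [q] pays for them, leaving the weight [q] per event, summed by [sum_logs], and a spare factor
    [rho ^+ k]. *)
Lemma card_has_log M :
  #|[set rnd | has (fun L => admissible L && consistent rnd L) (logs vars M setT)]|%:R
  <= rho ^+ k * (1 + x) ^+ #|V| * #|{: table}|%:R.
Proof.
apply: le_trans (card_has_le _ (fun L rnd => admissible L && consistent rnd L) _) _.
apply: le_trans (_ : rho ^+ k * #|{: table}|%:R *
  (\sum_(L <- logs vars M setT) q ^+ (\sum_(J <- L) #|J|)) <= _); last first.
  rewrite -!mulrA [_ ^+ _ * #|_|%:R]mulrC !mulrA ler_wpM2l ?mulr_ge0 ?exprn_ge0 //.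
  by rewrite -cardsT; apply: (sum_logs _ _ q_ge0 x_ge0 q_x).
rewrite mulr_sumr; apply: ler_sum => L _.
have [/and4P[ind hm hk hN]|_] /= := boolP (admissible L); last first.
  by rewrite eq_card0 ?mulr_ge0 ?exprn_ge0 // => f; rewrite inE.
apply: le_trans (card_consistent ind hm) _; rewrite mulrAC ler_wpM2r //.
have -> : (\sum_(J <- L) #|J| = inner_size L + outer_size L)%N.
  by rewrite -big_split; apply: eq_bigr => J _ /=; rewrite cardsID.
apply: le_trans (p_q hN) _; rewrite ler_wpM2r ?exprn_ge0 //.
exact: ler_wiXn2l.
Qed.

(** * Growing a log one event at a time *)

Definition occ (L : seq {set V}) (c : V) : nat := (\sum_(J <- L) (c \in J))%N.

Lemma sum_card_occ (Q : {set V}) L : (\sum_(J <- L) #|J :&: Q| = \sum_(c in Q) occ L c)%N.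
Proof.
rewrite exchange_big; apply: eq_bigr => J _.
rewrite -sum1_card big_mkcond [RHS]big_mkcond /=; apply: eq_bigr => c _.
by rewrite inE andbC; do 2!case: (c \in _).
Qed.

Lemma inner_size_occ L : inner_size L = (\sum_(c in P) occ L c)%N.
Proof. exact: sum_card_occ. Qed.

Lemma outer_size_occ L : outer_size L = (\sum_(c in ~: P) occ L c)%N.
Proof. by rewrite -sum_card_occ; apply: eq_bigr => J _; rewrite setDE. Qed.

Lemma reads_occ L y :
  reads L (size L) y = (\sum_(c | y \in vars c) occ L c)%N.
Proof.
rewrite -(eq_bigl _ _ (fun c => in_set _ c)) -sum_card_occ (big_nth set0).
by apply: eq_bigr => i _; congr #|pred_of_set _|; apply/setP => c; rewrite !inE.
Qed.

Lemma chained_nth (A : {set V}) L : nth set0 L 0 \subset A ->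
  (forall i, nth set0 L i.+1 \subset adj_set vars (nth set0 L i)) -> chained vars A L.
Proof.
elim: L A => //= J L IH A -> hL /=; apply: IH; first exact: (hL 0%N).
by move=> i; apply: (hL i.+1).
Qed.

Lemma adjC c c' : adj vars c c' = adj vars c' c.
Proof. by rewrite /adj setIC. Qed.

(** Past the end [nth] returns the empty set, so the adjacency condition is trivially true there and
    survives padding. *)
Definition log_wf (rnd : table) L :=
  [/\ forall i, nth set0 L i.+1 \subset adj_set vars (nth set0 L i),
      all independent L & consistent rnd L].

(* A new event is placed directly above the topmost level that contains an
   adjacent clause, so that it does not change what the other events read. *)
Lemma log_insert (rnd : table) L c : log_wf rnd L -> vars c != set0 ->
  (c \in P -> assignment rnd L (size L) \in bad c) ->
  exists L', [/\ log_wf rnd L', size L' = (size L).+1,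
    forall c', occ L' c' = (occ L c' + (c' == c))%N &
    forall y, reads L' (size L') y = (reads L (size L) y + (y \in vars c))%N].
Proof.
move=> [hch hind hcons] c0 hbad.
have adjcc : adj vars c c by rewrite /adj setIid.
(* [free i]: nothing at level [i] or above is adjacent to [c]. The least such level is where [c] is
   inserted. *)
pose free i := all (fun J : {set V} => [forall c' in J, ~~ adj vars c' c]) (drop i L).
have hfree : exists i, free i by exists (size L); rewrite /free drop_size.
case: (ex_minnP hfree) => l free_l minl.
have ll : (l <= size L)%N by apply: minl; rewrite /free drop_size.
have nadj i c' : (l <= i)%N -> c' \in nth set0 L i -> ~~ adj vars c' c.
  move=> li; have [hi|hi] := ltnP i (size L); last by rewrite nth_default ?inE.
  move=> c'i; have : nth set0 L i \in drop l L.
    by rewrite -(subnKC li) -nth_drop mem_nth // size_drop ltn_sub2r // (leq_ltn_trans li).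
  by move/(allP free_l)/forall_inP; apply.
have adjl i : l = i.+1 -> exists2 c', c' \in nth set0 L i & adj vars c' c.
  move=> li; have /negP : ~ free i by move/minl; rewrite li ltnn.
  rewrite /free (drop_nth set0); last by rewrite -li.
  rewrite -li /= negb_and -/(free l) free_l orbF.
  by rewrite negb_forall_in => /exists_inP[c' h]; rewrite negbK => h'; exists c'.
pose lev i := if i == l then c |: nth set0 L i else nth set0 L i.
pose L' := mkseq lev (size L).+1.
have nthL' i : nth set0 L' i = lev i.
  have [hi|hi] := ltnP i (size L).+1; first by rewrite nth_mkseq.
  rewrite /lev !nth_default ?size_mkseq //; last exact: ltnW.
  by case: eqP => // il; rewrite il ltnNge ll in hi.
have sL' : size L' = (size L).+1 by rewrite size_mkseq.
have cl : c \notin nth set0 L l by apply/negP => /(nadj _ _ (leqnn l)); rewrite adjcc.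
have subL i : nth set0 L i \subset lev i.
  by rewrite /lev; case: eqP => // _; rewrite subsetUr.
have readsL' j y : reads L' j y = (reads L j y + ((l < j) && (y \in vars c)))%N.
  elim: j => [|j IH]; first by rewrite /reads !big_geq.
  have E : (#|[set e in lev j | y \in vars e]|
      = #|[set e in nth set0 L j | y \in vars e]| + ((j == l) && (y \in vars c)))%N.
    rewrite /lev; have [->|jl] := eqVneq j l; last by rewrite addn0.
    case: (boolP (y \in vars c)) => yc.
      rewrite (_ : [set _ in _ | _] = c |: [set e in nth set0 L l | y \in vars e]).
        by rewrite cardsU1 inE (negPf cl) /= addnC.
      by apply/setP => e; rewrite !inE; case: eqP => [->|].
    rewrite /= addn0; apply: eq_card => e; rewrite !inE.
    by case: eqP => [->|//]; rewrite (negPf yc) !andbF.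
  move: IH; rewrite /reads !big_nat_recr //= nthL' E => -> {E}.
  by rewrite ltnS; case: (ltngtP l j); case: (y \in vars c) => /= _;
    rewrite ?addn0 ?addnA // addnAC.
have occL' c' : occ L' c' = (occ L c' + (c' == c))%N.
  rewrite /occ !(big_nth set0) sL' !big_mkord.
  transitivity (\sum_(i < (size L).+1)
      ((c' \in nth set0 L i) + ((i : nat) == l) * (c' == c)))%N.
    apply: eq_bigr => i _; rewrite nthL' /lev; case: eqP => [->|_]; last by rewrite addn0.
    by rewrite !inE mul1n; case: eqP => [->|]; rewrite ?(negPf cl) ?addn0.
  rewrite big_split /= big_ord_recr /= (nth_default _ (leqnn _)) inE addn0; congr addn.
  rewrite -big_distrl /= (bigD1 (Ordinal (ll : l < (size L).+1)%N)) //= eqxx.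
  by rewrite big1 ?addn0 ?mul1n // => i; rewrite -val_eqE /= => /negPf ->.
have lev_in i e : e \in lev i -> (i == l) && (e == c) \/ e \in nth set0 L i.
  rewrite /lev; case: eqP => _ /=; last by move=> ?; right.
  by rewrite in_setU1 => /orP[h|h]; [left|right].
exists L'; split => //; last first.
  move=> y; rewrite readsL' sL' ltnS ll; congr addn.
  rewrite /reads big_nat_recr //= eq_card0 ?addn0 // => e.
  by rewrite inE nth_default // inE.
split.
- move=> i; rewrite !nthL'; apply/subsetP => e /lev_in[/andP[/eqP il /eqP ->]|].
    rewrite inE; have [c' c'i ac] := adjl i (esym il).
    by apply/existsP; exists c'; rewrite (subsetP (subL i)).
  move/(subsetP (hch i)); rewrite !inE => /existsP[c' /andP[c'i ac]].
  by apply/existsP; exists c'; rewrite (subsetP (subL i)).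
- apply/(all_nthP set0) => i; rewrite sL' nthL' ltnS => iL.
  have ind e e' : e \in nth set0 L i -> e' \in nth set0 L i -> adj vars e e' -> e = e'.
    move=> eL e'L ae; have [hi|hi] := ltnP i (size L); last first.
      by rewrite nth_default ?inE in eL.
    have /forall_inP/(_ e eL)/forall_inP/(_ e' e'L)/implyP/(_ ae)/eqP :=
      allP hind _ (mem_nth set0 hi).
    by [].
  apply/forall_inP => e he; apply/forall_inP => e' he'; apply/implyP => ae; apply/eqP.
  case: (lev_in i e he) => [/andP[/eqP il /eqP ec]|eL];
    case: (lev_in i e' he') => [/andP[/eqP il' /eqP ec']|e'L].
  + by rewrite ec ec'.
  + by move: ae; rewrite ec adjC (negPf (nadj i e' _ e'L)) // il.
  + by move: ae; rewrite ec' (negPf (nadj i e _ eL)) // il'.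
  + exact: ind.
- apply/allP => -[i e]; rewrite mem_inner_events nthL' => /and3P[_ /lev_in he eP] /=.
  case: he => [/andP[/eqP -> /eqP ec]|eL].
    (* No old event from level [l] on touches a variable of [c], so at level [l] the new event reads
       the same cells as at the top. *)
    rewrite -(bad_vars (f := assignment rnd L (size L))); first by rewrite ec hbad // -ec.
    move=> y; rewrite ec => yc; rewrite !ffunE readsL' ltnn addn0.
    congr (rnd (_, inord _)).
    rewrite /reads (@big_cat_nat _ _ _ l 0 (size L)) //=.
    rewrite -[RHS]addn0; congr addn; rewrite big_nat big1 // => j /andP[lj _].
    apply: eq_card0 => c'; rewrite !inE.
    apply/negP => /andP[c'i yc']; move: (nadj j c' lj c'i).
    by rewrite /adj negbK => /eqP/setP/(_ y); rewrite !inE yc yc'.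
  have iS : (i < size L)%N.
    by rewrite ltnNge; apply/negP => h; rewrite nth_default ?inE in eL.
  have he : assignment rnd L i \in bad e.
    by apply: (allP hcons (i, e)); rewrite mem_inner_events iS eL.
  rewrite (bad_vars (g := assignment rnd L i)) // => y ye; rewrite !ffunE readsL'.
  congr (rnd (_, inord _)).
  (* An old event above level [l] shares no variable with [c], so its indices do not move. *)
  case: ltnP => //= li; last by rewrite addn0.
  case: (boolP (y \in vars c)) => [yc|]; last by rewrite addn0.
  have := nadj i e (ltnW li) eL; rewrite /adj negbK => /eqP/setP/(_ y).
  by rewrite !inE yc ye.
Qed.

Lemma nth_rcons_set0 (L : seq {set V}) i : nth set0 (rcons L set0) i = nth set0 L i.
Proof. by rewrite nth_rcons; case: ltnP => // h; rewrite if_same nth_default. Qed.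

(** Serves the time steps at which no clause of the ball fires, so that the number of levels equals
    the elapsed time; also used for padding. *)
Lemma log_rcons0 (rnd : table) L : log_wf rnd L ->
  [/\ log_wf rnd (rcons L set0), forall c, occ (rcons L set0) c = occ L c &
      forall y, reads (rcons L set0) (size (rcons L set0)) y = reads L (size L) y].
Proof.
move=> [hch hind hcons].
have readsE l y : reads (rcons L set0) l y = reads L l y.
  by apply: eq_bigr => i _; apply: eq_card => c; rewrite !inE nth_rcons_set0.
split=> [|c|y].
- split=> [i||]; first by rewrite !nth_rcons_set0.
    by rewrite all_rcons hind andbT; apply/forall_inP => c; rewrite inE.
  apply/allP => -[l c]; rewrite mem_inner_events nth_rcons_set0 => /and3P[_ cl cP] /=.
  have lS : (l < size L)%N.
    by rewrite ltnNge; apply/negP => h; rewrite nth_default ?inE in cl.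
  rewrite (_ : assignment _ _ _ = assignment rnd L l).
    by apply: (allP hcons (l, c)); rewrite mem_inner_events lS cl.
  by apply/ffunP => y; rewrite !ffunE readsE.
- by rewrite /occ -cats1 big_cat big_seq1 inE /= addn0.
- rewrite readsE size_rcons /reads big_nat_recr //= eq_card0 ?addn0 // => c.
  by rewrite inE nth_default // inE.
Qed.
End LocalBound.

Local Close Scope ring_scope.

From mathcomp Require Import finmap boolp classical_sets functions cardinality reals.
From mathcomp Require Import measurable_structure measurable_function sequences exp.
From mathcomp Require Import lra zify.
Local Open Scope classical_set_scope.

(** * Borel colourings *)

(** A countable stand-in for the topology: it makes inequality of points expressible by countably
    many Borel sets. *)
Definition separates_finite T (A : nat -> set T) :=
  forall x (F : set T), finite_set F -> ~ F x -> exists2 n, A n x & A n `&` F = set0.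

Section Coloring.
Context d (Omega : measurableType d) (A : nat -> set Omega) (E : Omega -> Omega -> Prop).
Hypothesis A_meas : forall n, measurable (A n).
Hypothesis A_sep : separates_finite A.
Hypothesis E_sym : forall x y, E x y -> E y x.
Hypothesis E_fin : forall x, finite_set [set y | E x y].
Variable M : nat.
Hypothesis E_deg : forall x, (#|` fset_set [set y | E x y]| <= M)%N.

Definition rel_preim (B : set Omega) : set Omega := [set x | exists2 y, E x y & B y].
Hypothesis rel_preim_meas : forall B, measurable B -> measurable (rel_preim B).

(** The points of [A n] with no other [E]-neighbour in [A n]; that the neighbour differs from the
    point is witnessed by some [A m] containing only the latter. *)
Let W n := A n `\` \bigcup_m (A m `&` rel_preim (A n `\` A m)).

Let W_meas n : measurable (W n).
Proof.
apply: measurableD => //; apply: bigcupT_measurable => m.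
by apply: measurableI => //; apply: rel_preim_meas; apply: measurableD.
Qed.

Let W_indep n x y : W n x -> A n y -> E x y -> x = y.
Proof.
move=> [Ax nx] Ay Exy; apply: contrapT => xy; apply: nx.
have [m Am Amy] := A_sep (finite_set1 y) xy.
exists m => //; split => //; exists y => //; split => // Ay'.
by have : (A m `&` [set y]) y by []; rewrite Amy.
Qed.

Let W_cover x : exists n, W n x.
Proof.
have fF : finite_set ([set y | E x y] `\ x) by apply: finite_setD.
have [|n Ax AF] := A_sep fF (x := x); first by case=> _; apply.
exists n; split => // -[m _ [Amx [y Exy [Any Amy]]]].
suff : (A n `&` ([set y | E x y] `\ x)) y by rewrite AF.
by split=> //; split=> // yx; apply: Amy; rewrite yx.
Qed.

(* First-fit colouring: at stage [s] the yet uncoloured points of the independent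
   set [W s] receive the least colour not used by their neighbours. *)
Fixpoint greedy (s j : nat) : set Omega :=
  if s is s'.+1 then
    greedy s' j `|` ((W s' `\` \bigcup_i greedy s' i `\` rel_preim (greedy s' j))
                     `&` \bigcap_(i in `I_j) rel_preim (greedy s' i))
  else set0.

Let greedy_meas s j : measurable (greedy s j).
Proof.
elim: s j => [|s IH] j //=; apply: measurableU => //; apply: measurableI.
  apply: measurableD; last exact: rel_preim_meas.
  by apply: measurableD => //; apply: bigcupT_measurable.
by apply: bigcap_measurableType => // i _; apply: rel_preim_meas.
Qed.

Let greedy_mono s s' j : (s <= s')%N -> greedy s j `<=` greedy s' j.
Proof.
move/subnKC <-; elim: (s' - s)%N => [|k IH]; rewrite ?addn0 ?addnS //=.
by move=> x /IH; left.
Qed.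

Let greedy_uniq s j j' x : greedy s j x -> greedy s j' x -> j = j'.
Proof.
elim: s => //= s IH [h|[[[_ h] hj] lj]] [h'|[[[_ h'] hj'] lj']].
- exact: IH.
- by exfalso; apply: h'; exists j.
- by exfalso; apply: h; exists j'.
- by case: (ltngtP j j') => // jj; [have := lj' _ jj|have := lj _ jj].
Qed.

(** Pigeonhole: if all of the [M.+1] colours were blocked, [x] would have [M.+1] distinct
    neighbours. *)
Let rel_preim_bound s x : ~ (forall i, (i <= M)%N -> rel_preim (greedy s i) x).
Proof.
move=> h; have {h} /choice[f hf] i : exists y, (i <= M)%N -> E x y /\ greedy s i y.
  have [iM|] := leqP i M; last by exists x.
  by have [y ? ?] := h i iM; exists y.
have : uniq [seq f i | i <- iota 0 M.+1].
  rewrite map_inj_in_uniq ?iota_uniq // => i j; rewrite !mem_iota /= !add0n !ltnS => iM jM fij.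
  have [_ gi] := hf i iM; have [_ gj] := hf j jM; rewrite fij in gi.
  exact: greedy_uniq gi gj.
move/uniq_leq_size => /(_ (fset_set [set y | E x y])).
rewrite size_map size_iota => H.
suff : (M.+1 <= #|` fset_set [set y | E x y]|)%N by rewrite ltnNge E_deg.
apply: H => y /mapP[i]; rewrite mem_iota add0n ltnS => /= iM ->.
by rewrite in_fset_set // inE; have [] := hf i iM.
Qed.

Let greedy_le s j x : greedy s j x -> (j <= M)%N.
Proof.
elim: s => //= s IH [//|[_ lj]]; rewrite leqNgt; apply/negP => Mj.
by apply: (@rel_preim_bound s x) => i iM; apply: lj => /=; apply: leq_ltn_trans Mj.
Qed.

Let greedy_cover x : exists j s, greedy s j x.
Proof.
have [s Ws] := W_cover x.
have [[j _ ?]|hx] := pselect ((\bigcup_i greedy s i) x); first by exists j, s.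
have ex : exists j, `[< ~ rel_preim (greedy s j) x >].
  apply: contrapT => h; apply: (@rel_preim_bound s x) => i _; apply: contrapT => h'.
  by apply: h; exists i; apply/asboolP.
case: (ex_minnP ex) => j /asboolP nj minj.
exists j, s.+1; right; split=> // i /= ij; apply: contrapT => h.
by move: ij; rewrite ltnNge minj //; apply/asboolP.
Qed.

(** Two points coloured at the same stage both lie in the independent set [W s]; otherwise the later
    one avoided the colour of the earlier one. *)
Let greedy_indep s j x y : greedy s j x -> greedy s j y -> E x y -> x = y.
Proof.
elim: s => //= s IH [h|[[[W1 _] hj] lj]] [h'|[[[W2 _] hj'] lj']] Exy.
- exact: IH.
- by exfalso; apply: hj'; exists x => //; apply: E_sym.
- by exfalso; apply: hj; exists y.
- by apply: W_indep W1 _ Exy; case: W2.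
Qed.

Lemma borel_coloring : exists col : Omega -> 'I_M.+1,
  (forall c, measurable (col @^-1` [set c])) /\
  forall x y, E x y -> col x = col y -> x = y.
Proof.
have /choice[c hc] := greedy_cover.
have cM x : (c x < M.+1)%N by rewrite ltnS; have [s /greedy_le] := hc x.
pose col x := Ordinal (cM x); exists col; split.
  move=> j; rewrite (_ : _ @^-1` _ = \bigcup_s greedy s j); first exact: bigcupT_measurable.
  apply/seteqP; split=> x /=; first by move=> <-; have [s] := hc x; exists s.
  move=> [s _ hs]; apply/val_inj => /=; have [s' hs'] := hc x.
  by apply: (@greedy_uniq (maxn s s') _ _ x); [apply: greedy_mono hs'|apply: greedy_mono hs];
    rewrite ?leq_maxl ?leq_maxr.
move=> x y Exy [cxy]; have [s hs] := hc x; have [s' hs'] := hc y.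
apply: (@greedy_indep (maxn s s') (c x)) => //.
  by apply: greedy_mono hs; rewrite leq_maxl.
by rewrite cxy; apply: greedy_mono hs'; rewrite leq_maxr.
Qed.
End Coloring.

(** * Measurability of the local rule *)

Section StandardBorel.
Local Open Scope ring_scope.

Lemma metric_finite_gap (R : realType) (T : choiceType) (dist : T -> T -> R) (F : set T) x :
  is_metric dist -> finite_set F -> ~ F x ->
  exists2 e : R, 0 < e & forall y, F y -> e <= dist x y.
Proof.
move=> [d0 dE _ _] /finite_seqP[s ->] /=; elim: s => [_|a s IH].
  by exists 1.
move/negP; rewrite inE negb_or => /andP[xa /negP/IH[e e0 he]].
exists (Num.min e (dist x a)); first rewrite lt_min e0 lt_def d0 andbT.
  by apply/eqP => /dE xa'; rewrite xa' eqxx in xa.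
move=> y; rewrite /= inE => /orP[/eqP ->|/he h]; rewrite ge_min ?lexx ?orbT //.
by rewrite h.
Qed.

(** The family consists of the balls of radius [1/(m+1)] around a countable dense set. A ball that
    contains [x] and has radius below half the gap between [x] and [F] misses [F]. *)
Lemma standard_borel_separates (R : realType) d (Omega : measurableType d) :
  standard_borel R Omega ->
  exists2 A : nat -> set Omega, forall n, measurable (A n) & separates_finite A.
Proof.
move=> [dist [mdist _ [D [/countable_injP[f fI] Ddense]] measE]].
have [d0 dE dC dT] := mdist.
pose ball i m : set Omega := [set y | exists q, [/\ D q, f q = i & dist q y < m.+1%:R^-1]].
pose A n := if (choice.unpickle n : option (nat * nat)) is Some u then ball u.1 u.2 else set0.
exists A => [n|x F fF Fx].
  rewrite /A; case: choice.unpickle => // -[i m] /=; rewrite measE; apply: sub_sigma_algebra.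
  move=> y [q [Dq fq qy]]; exists (m.+1%:R^-1 - dist q y); first by rewrite subr_gt0.
  move=> z /= yz; exists q; split=> //.
  by rewrite (le_lt_trans (dT q y z)) // addrC -ltrBrDr.
have [e e0 he] := metric_finite_gap mdist fF Fx.
have e2 : 0 < e / 2 by rewrite divr_gt0.
have [m hm] : exists m, m.+1%:R^-1 < e / 2.
  exists (Num.truncn (e / 2)^-1); rewrite invf_plt ?posrE //.
  exact: truncnS_gt.
have [|q Dq xq] := Ddense x m.+1%:R^-1; first by rewrite invr_gt0.
exists (choice.pickle (f q, m)); rewrite /A choice.pickleK /=; first by exists q; rewrite dC.
apply/seteqP; split=> // y [[q' [Dq' fq' qy]] Fy].
have qq : q' = q by apply: fI; rewrite ?inE.
subst q'.
have := he y Fy; apply/negP; rewrite -ltNge.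
apply: le_lt_trans (dT x q y) _; rewrite [e]splitr.
by apply: ltrD; apply: lt_trans hm.
Qed.

End StandardBorel.

Lemma ncardE (T : choiceType) (A : set T) : finite_set A -> ncard A = #|` fset_set A|.
Proof.
move=> /finite_setP[n An]; rewrite /ncard; case: xgetP => [m _ /= Am|/(_ n)]; last by [].
by rewrite (card_fset_set Am).
Qed.

Section Graph.
Context d (Omega : measurableType d) (U : nat -> set Omega) (gam : nat -> Omega -> Omega).
Hypothesis arrows : borel_arrows U gam.
Variable A : nat -> set Omega.
Hypotheses (A_meas : forall n, measurable (A n)) (A_sep : separates_finite A).

Let arr_meas i B : measurable B -> measurable (U i `&` gam i @^-1` B).
Proof. by move=> mB; have [mU _ mg _] := arrows i; apply: mg. Qed.

Lemma rel_preim_edge_measurable B : measurable B -> measurable (rel_preim (edge U gam) B).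
Proof.
move=> mB; rewrite (_ : rel_preim _ _ = \bigcup_i (U i `&` gam i @^-1` B)).
  by apply: bigcupT_measurable => i; apply: arr_meas.
by apply/seteqP; split=> x; [move=> [y [i [Ux <-]] By]; exists i|
  move=> [i _ [Ux Bx]]; exists (gam i x) => //; exists i].
Qed.

Let clash i j := [set x | [/\ U i x, U j x & gam i x = gam j x]].

(** Two arrows disagree at [x] exactly when some [A n] contains one image and misses the other. *)
Let clash_meas i j : measurable (clash i j).
Proof.
have -> : clash i j = (U i `&` U j) `\`
    \bigcup_n ((U i `&` gam i @^-1` A n) `\` (U j `&` gam j @^-1` A n)).
  apply/seteqP; split=> x /=.
    by move=> [Ui Uj E]; split=> // -[n _ [[_ h] h']]; apply: h'; rewrite /= -E.
  move=> [[Ui Uj] h]; split=> //; apply: contrapT => ne; apply: h.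
  have [n An AF] := A_sep (finite_set1 (gam j x)) ne.
  exists n => //; split=> // -[_ h].
  by have : (A n `&` [set gam j x]) (gam j x) by []; rewrite AF.
have mU k : measurable (U k) by have [] := arrows k.
apply: measurableD; first exact: measurableI.
by apply: bigcupT_measurable => n; apply: measurableD; apply: arr_meas.
Qed.

(** Here [i] is the least index of the neighbour [gam i x], so these indices list [N(x)] in its
    order without repetition. *)
Definition new_arrow i := U i `\` \bigcup_(j in `I_i) clash i j.

Lemma new_arrow_measurable i : measurable (new_arrow i).
Proof.
by apply: measurableD; [have [] := arrows i|apply: bigcup_measurable => j _].
Qed.

Lemma new_arrowP x y : edge U gam x y -> exists2 i, new_arrow i x & gam i x = y.
Proof.
move=> [i0 hi0]; have ex : exists i, `[< U i x /\ gam i x = y >] by exists i0; apply/asboolP.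
case: (ex_minnP ex) => i /asboolP[Ui giy] mini; exists i => //; split=> // -[j /= ji [_ Uj E]].
by move: ji; rewrite ltnNge mini //; apply/asboolP; rewrite -E.
Qed.

Lemma new_arrow_inj i j x : new_arrow i x -> new_arrow j x -> gam i x = gam j x -> i = j.
Proof.
move=> [Ui hi] [Uj hj] E; case: (ltngtP i j) => // ij; exfalso.
  by apply: hj; exists i.
by apply: hi; exists j.
Qed.

Lemma new_arrow_edge i x : new_arrow i x -> edge U gam x (gam i x).
Proof. by move=> [Ui _]; exists i. Qed.

Lemma nltE i j x : new_arrow i x -> new_arrow j x ->
  nlt U gam x (gam i x) (gam j x) <-> i < j.
Proof.
move=> hi hj; split=> [[l [[Ul El] hl]]|ij].
  rewrite ltnNge; apply/negP => ji; have [Uj _] := hj.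
  have [lj|jl] := ltnP l j; last by apply: (hl j).
  have [_ hi'] := hi; apply: hi'; exists l; first exact: leq_trans lj ji.
  by split => //; case: hi.
exists i; split; first by case: hi.
move=> l li [Ul El]; have [Uj hj'] := hj; apply: hj'; exists l => //=.
exact: leq_ltn_trans ij.
Qed.

(** When [new_arrow i x] holds, this is the rank of [gam i x] in [N(x)], written as a count of Borel
    conditions. *)
Definition position i x := \sum_(j < i) `[< new_arrow j x >].

Lemma position_measurable i k : measurable [set x | position i x = k].
Proof.
elim: i k => [|i IH] k.
  have [<-|k0] := eqVneq 0 k.
    by rewrite (_ : [set x | _] = setT) //; apply/seteqP; split=> // x _; apply: big_ord0.
  rewrite (_ : [set x | _] = set0) //; apply/seteqP; split=> // x /=.
  by rewrite /position big_ord0 => /eqP; rewrite (negPf k0).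
have -> : [set x | position i.+1 x = k] =
   ([set x | position i x = k] `\` new_arrow i) `|`
   ([set x | (position i x).+1 = k] `&` new_arrow i).
  have posS x : position i.+1 x = position i x + `[< new_arrow i x >].
    by rewrite /position big_ord_recr.
  apply/seteqP; split=> x /=; rewrite posS;
    case: asboolP => h; rewrite ?addn0 ?addn1.
  - by right.
  - by left.
  - by case=> -[].
  - by case=> -[].
have mk : measurable [set x | (position i x).+1 = k].
  case: k => [|k]; first by rewrite (_ : [set x | _] = set0) //; apply/seteqP; split.
  rewrite (_ : [set x | _] = [set x | position i x = k]) //.
  by apply/seteqP; split=> x /=; [case|move=> ->].
apply: measurableU; first by apply: measurableD => //; apply: new_arrow_measurable.
by apply: measurableI => //; apply: new_arrow_measurable.
Qed.

Lemma nrankE i x : new_arrow i x -> nrank U gam x (gam i x) = position i x.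
Proof.
move=> hi; rewrite /nrank; pose s := [seq j <- iota 0 i | `[< new_arrow j x >]].
have -> : [set z | edge U gam x z /\ nlt U gam x z (gam i x)] =
    [set` [seq gam j x | j <- s]].
  apply/seteqP; split=> [z /= [/new_arrowP[j hj <-]]|z /= /mapP[j]].
    move/(nltE hj hi) => ji; apply/mapP; exists j => //.
    by rewrite mem_filter mem_iota /= ji andbT; apply/asboolP.
  rewrite mem_filter mem_iota /= => /andP[/asboolP hj ji] ->.
  by split; [exact: new_arrow_edge|apply/nltE].
have us : uniq [seq gam j x | j <- s].
  rewrite map_inj_in_uniq ?filter_uniq ?iota_uniq // => j l.
  rewrite !mem_filter => /andP[/asboolP hj _] /andP[/asboolP hl _].
  exact: new_arrow_inj.
rewrite ncardE; last exact: finite_seq.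
have -> : fset_set [set` [seq gam j x | j <- s]] = [fset z in [seq gam j x | j <- s]]%fset.
  by rewrite -[RHS]set_fsetK; congr fset_set; apply/seteqP; split=> z /=; rewrite inE.
rewrite card_fseq undup_id // size_map size_filter -sum1_count /position.
rewrite -(big_mkord xpredT (fun j => nat_of_bool `[< new_arrow j x >])) /index_iota subn0.
by rewrite big_mkcond; apply: eq_bigr => j _; case: asboolP.
Qed.

Section Rule.
Variables (b Delta : nat) (Rl : forall x, set ({y : Omega | edge U gam x y} -> 'I_b)).
Hypothesis nbhd_fin : forall x, finite_set (nbhd U gam x).
Hypothesis deg_le : forall x, deg U gam x <= Delta.
Hypothesis Rl_borel : borel_local_rule Rl.

Lemma nrank_lt x y : edge U gam x y -> nrank U gam x y < deg U gam x.
Proof.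
move=> xy; have fN := nbhd_fin x.
have fS : finite_set [set z | edge U gam x z /\ nlt U gam x z y].
  by apply: sub_finite_set fN => z [].
rewrite /nrank /deg !ncardE //; apply: fproper_ltn_card; rewrite fproperE; apply/andP; split.
  by apply/fsubsetP => z; rewrite !in_fset_set // !inE => -[].
apply/fsubsetPn; exists y; rewrite in_fset_set // ?inE //.
by apply/negP; rewrite inE => -[_] [i [hi /(_ i (leqnn i))]].
Qed.

Lemma nrank_inj x y z : edge U gam x y -> edge U gam x z ->
  nrank U gam x y = nrank U gam x z -> y = z.
Proof.
have lt_pos i j : i < j -> new_arrow i x -> position i x < position j x.
  move=> ij hi; rewrite /position -!(big_mkord xpredT (fun j => nat_of_bool `[< new_arrow j x >])).
  rewrite [X in _ < X](@big_cat_nat _ _ _ i.+1) //= big_nat_recr //=.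
  by rewrite (asboolT hi) addn1 ltnS leq_addr.
move=> /new_arrowP[i hi <-] /new_arrowP[j hj <-]; rewrite !nrankE // => E.
case: (ltngtP i j) => [ij|ij|-> //]; exfalso.
  by have := lt_pos _ _ ij hi; rewrite E ltnn.
by have := lt_pos _ _ ij hj; rewrite E ltnn.
Qed.

(** Replaces functions on the varying type of neighbours of [x] by sequences, of which there are
    countably many. *)
Lemma rule_seqP (f : Omega -> 'I_b) x :
  Rl (fun y : {y | edge U gam x y} => f (sval y)) <->
  exists2 s, rule_seq Rl x s &
    forall y, edge U gam x y -> nth (f y) s (nrank U gam x y) = f y.
Proof.
split=> [Rf|[s [g Rg [ss hs]] hf]]; last first.
  suff -> : (fun y : {y | edge U gam x y} => f (sval y)) = g by [].
  apply/funext => -[y xy] /=; rewrite -(hf y xy) -(hs y xy).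
  by apply: set_nth_default; rewrite ss nrank_lt.
(* [f x] is a dummy value for positions that are no neighbour's rank. *)
pose h k := if pselect (exists y, edge U gam x y /\ nrank U gam x y = k) is left e
  then f (sval (cid e)) else f x.
pose s := mkseq h (deg U gam x).
have hs y z : edge U gam x y -> nth (f z) s (nrank U gam x y) = f y.
  move=> xy; rewrite nth_mkseq ?nrank_lt // /h; case: pselect => [e|]; last first.
    by case; exists y.
  by case: (cid e) => z' /= [xz' /(nrank_inj xz' xy) ->].
by exists s => [|y xy]; [exists (fun y => f (sval y)) => //; rewrite size_mkseq; split=> // y xy|];
  exact: hs.
Qed.

(** The sequences have length at most [Delta], so only finitely many sets [R'(x)] can occur; take
    the union over those containing [s]. *)
Lemma rule_seq_measurable s : measurable [set x | rule_seq Rl x s].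
Proof.
pose F (a : {set Delta.-bseq 'I_b}) : set (seq 'I_b) := [set u | exists2 t, t \in a & val t = u].
have -> : [set x | rule_seq Rl x s] =
    \bigcup_(a in [set a | F a s]) [set x | rule_seq Rl x = F a].
  apply/seteqP; split=> [x /= hs|x [a /= Fs ->] //].
  have E : rule_seq Rl x = F (finset (fun t : Delta.-bseq 'I_b => `[< rule_seq Rl x (val t) >])).
    apply/seteqP; split=> [u hu|u [t]]; last by rewrite finset.inE => /asboolP ? <-.
    have su : size u <= Delta by have [g _ [-> _]] := hu.
    by exists (Bseq su); rewrite ?finset.inE //; apply/asboolP.
  by exists (finset (fun t : Delta.-bseq 'I_b => `[< rule_seq Rl x (val t) >])) => //=; rewrite -E.
apply: fin_bigcup_measurable => // a _; exact: Rl_borel.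
Qed.

(** A countable union over candidate sequences [s], each time removing the points where some new
    arrow [i], of position [k], leads to a value that differs from entry [k] of [s]. *)
Lemma rule_measurable (f : Omega -> 'I_b) :
  (forall k, measurable (f @^-1` [set k])) ->
  measurable [set x | Rl (fun y : {y | edge U gam x y} => f (sval y))].
Proof.
move=> mf.
have mfP (P : 'I_b -> Prop) : measurable [set y | P (f y)].
  rewrite (_ : [set y | _] = \bigcup_(k in P) (f @^-1` [set k])).
    by apply: fin_bigcup_measurable => //; exact: finite_finset.
  by apply/seteqP; split=> y; [exists (f y)|case=> k Pk /= ->].
have -> : [set x | Rl (fun y : {y | edge U gam x y} => f (sval y))] =
   \bigcup_s ([set x | rule_seq Rl x s] `\` \bigcup_i \bigcup_k
     (new_arrow i `&` [set x | position i x = k] `&`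
       (U i `&` gam i @^-1` [set y | nth (f y) s k <> f y]))).
  apply/seteqP; split=> x /=.
    move/rule_seqP => [s hs hf]; exists s => //; split=> // -[i _ [k _ [[hi <-] [Ui]]]] /=.
    by apply; rewrite -nrankE //; apply: hf; apply: new_arrow_edge.
  move=> [s _ [hs hf]]; apply/rule_seqP; exists s => // y xy; apply: contrapT => ne.
  have [i hi E] := new_arrowP xy; apply: hf; exists i => //; exists (position i x) => //.
  by split=> //; split; [case: hi|rewrite /= E -nrankE // E].
apply: countable_bigcupT_measurable => [|s]; first exact: countableP.
apply: measurableD; first exact: rule_seq_measurable.
apply: bigcupT_measurable => i; apply: bigcupT_measurable => k.
apply: measurableI; last exact/arr_meas/(mfP (fun a => nth a s k <> a)).
by apply: measurableI; [exact: new_arrow_measurable|exact: position_measurable].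
Qed.
End Rule.
End Graph.

(** * The resampling process *)

Section Walks.
Context (Omega : Type) (U : nat -> set Omega) (gam : nat -> Omega -> Omega).
Local Notation edge := (edge U gam).
Local Notation rel_edge := (rel_edge U gam).
Local Notation rel_walk := (rel_walk U gam).
Local Notation rel_ball := (rel_ball U gam).

Lemma rel_edge_sym x y : rel_edge x y -> rel_edge y x.
Proof. by move=> [z []]; exists z. Qed.

Lemma rel_walk_cat k l x y z : rel_walk k x y -> rel_walk l y z -> rel_walk (k + l) x z.
Proof.
elim: k x => [|k IH] x /=; first by move=> ->.
by move=> [u [xu uy]] yz; exists u; split=> //; apply: IH.
Qed.

Lemma rel_walk_sym k x y : rel_walk k x y -> rel_walk k y x.
Proof.
elim: k x y => //= k IH x y [u [/rel_edge_sym xu /IH uy]].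
have := @rel_walk_cat k 1 y u x uy; rewrite addn1; apply; exists x; split=> //.
Qed.

Lemma rel_ball_self v r : rel_ball v r v.
Proof. by exists 0. Qed.

Lemma rel_ball_le v r r' x : r <= r' -> rel_ball v r x -> rel_ball v r' x.
Proof. by move=> rr' [k kr w]; exists k => //; apply: leq_trans rr'. Qed.

Lemma rel_ball_sym v r x : rel_ball v r x -> rel_ball x r v.
Proof. by move=> [k kr w]; exists k => //; apply: rel_walk_sym. Qed.

Lemma rel_ball_edge v r x y : rel_ball v r x -> rel_edge x y -> rel_ball v r.+1 y.
Proof.
move=> [k kr w] xy; exists k.+1 => //; rewrite -addn1; apply: rel_walk_cat w _.
by exists y.
Qed.

Lemma rel_ball_center v r x y : rel_ball v r x -> rel_ball v r y -> rel_ball x (r + r) y.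
Proof.
move=> [k kr /rel_walk_sym w] [l lr w']; exists (k + l); first exact: leq_add.
exact: rel_walk_cat w w'.
Qed.

Hypothesis edge_sym : symmetric_graph U gam.

(** By symmetry two neighbours of one vertex are adjacent in [Rel(G)], so passing to neighbours of
    the endpoints costs one extra step. *)
Lemma rel_walk_nbhd k x x' y y' : rel_walk k x x' -> edge x y -> edge x' y' ->
  rel_walk k.+1 y y'.
Proof.
elim: k x y => [|k IH] x y /=.
  by move=> -> xy xy'; exists y'; split=> //; exists x'; split; apply/edge_sym.
move=> [u [[z [xz uz]] w]] xy xy'; exists z; split.
  by exists x; split; apply/edge_sym.
exact: (IH _ _ w).
Qed.

Lemma rel_ball_nbhd v r x x' y y' : rel_ball v r x -> rel_ball v r x' ->
  edge x y -> edge x' y' -> rel_ball y (r + r).+1 y'.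
Proof.
move=> vx vx' xy xy'; have [k kr w] := rel_ball_center vx vx'.
by exists k.+1 => //; apply: rel_walk_nbhd w xy xy'.
Qed.
End Walks.

(* Shared randomness: the [j]-th value ever given to [y] is [rnd (col y, j)], so
   that equally coloured points read the same random bits. *)
Section Process.
Context (Omega : Type) (U : nat -> set Omega) (gam : nat -> Omega -> Omega).
Local Notation edge := (edge U gam).
Local Notation rel_edge := (rel_edge U gam).
Local Notation rel_ball := (rel_ball U gam).
Variables (b n m : nat) (Rl : forall x, set ({y : Omega | edge x y} -> 'I_b)).
Variables (col : Omega -> 'I_n.+1) (rnd : {ffun 'I_n.+1 * 'I_m.+1 -> 'I_b}).

Definition guess (ptr : Omega -> nat) y := rnd (col y, inord (ptr y)).

(** Colour classes take turns. Since colours are distinct in large balls, at most one clause of such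
    a ball fires at each step. *)
Definition fires_at t (ptr : Omega -> nat) x :=
  (col x : nat) = t %% n.+1 /\ ~ @Rl x (fun y => guess ptr (sval y)).

Fixpoint ptr t : Omega -> nat :=
  if t is t'.+1 then
    fun y => (ptr t' y + `[< exists2 x, edge x y & fires_at t' (ptr t') x >])%N
  else fun=> 0%N.

Definition fires t := fires_at t (ptr t).

Definition runs t x := (\sum_(i < t) `[< fires i x >])%N.

Lemma runsS t x : runs t.+1 x = (runs t x + `[< fires t x >])%N.
Proof. by rewrite /runs big_ord_recr. Qed.

Lemma runs_mono s t x : s <= t -> runs s x <= runs t x.
Proof.
move/subnKC <-; elim: (t - s) => [|k IH]; rewrite ?addn0 // addnS runsS.
exact: leq_trans IH (leq_addr _ _).
Qed.

Hypothesis edge_sym : symmetric_graph U gam.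
Hypothesis Rl_isolated : forall x (f : {y | edge x y} -> 'I_b),
  (forall y, ~ edge x y) -> Rl f.

Section Local.
Variables (v : Omega) (r : nat).
(** Points of the ball of radius [r.+1] are within [2 * r + 2] of each other, and their neighbours
    within [2 * r + 3]; so colours can name both clauses and variables. *)
Hypothesis col_inj : forall x y, rel_ball x (2 * r + 3) y -> col x = col y -> x = y.
Local Notation name := 'I_n.+1.

Definition inner : {set name} := finset (fun c => `[< exists2 x, rel_ball v r x & col x = c >]).

(** The radius is [r.+1] because any clause sharing a variable with an inner one lies in that ball.
    Colours absent from it get an empty scope. *)
Definition vars (c : name) : {set name} := finset (fun w =>
  `[< exists x, [/\ rel_ball v r.+1 x, col x = c & exists2 y, edge x y & col y = w] >]).

Definition bad (c : name) : {set {ffun name -> 'I_b}} := finset (fun g : {ffun name -> 'I_b} =>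
  `[< exists x, [/\ rel_ball v r.+1 x, col x = c &
                 ~ @Rl x (fun y => g (col (sval y)))] >]).

Lemma col_ball x y : rel_ball v r.+1 x -> rel_ball v r.+1 y -> col x = col y -> x = y.
Proof.
move=> vx vy; apply: col_inj; apply: rel_ball_le (rel_ball_center vx vy); lia.
Qed.

Lemma col_nbhd x x' y y' : rel_ball v r.+1 x -> rel_ball v r.+1 x' ->
  edge x y -> edge x' y' -> col y = col y' -> y = y'.
Proof.
move=> vx vx' xy xy'; apply: col_inj.
apply: rel_ball_le (rel_ball_nbhd edge_sym vx vx' xy xy'); lia.
Qed.

Lemma vars_col x y : rel_ball v r.+1 x ->
  (exists2 y', edge x y' & col y' = y) <-> y \in vars (col x).
Proof.
move=> vx; rewrite inE; split=> [h|/asboolP[x' [vx' /col_ball <- //]]].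
by apply/asboolP; exists x.
Qed.

Lemma bad_col x (g : {ffun name -> 'I_b}) : rel_ball v r.+1 x ->
  ~ @Rl x (fun y => g (col (sval y))) <-> g \in bad (col x).
Proof.
move=> vx; rewrite inE; split=> [h|/asboolP[x' [vx' /col_ball <- //]]].
by apply/asboolP; exists x.
Qed.

Lemma depends_on_bad c : depends_on (vars c) (bad c).
Proof.
have H (f g : {ffun name -> 'I_b}) : {in vars c, f =1 g} -> f \in bad c -> g \in bad c.
  move=> fg; rewrite !finset.inE => /asboolP[x [vx xc h]]; apply/asboolP; exists x; split=> //.
  rewrite (_ : (fun y => _) = fun y : {y | edge x y} => f (col (sval y))) //.
  apply/funext => -[y xy] /=; rewrite fg //; rewrite -xc; apply/(vars_col _ vx).
  by exists y.
by move=> f g fg; apply/idP/idP; apply: H => // y yc; rewrite fg.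
Qed.

Lemma adj_vars c c' : adj vars c c' -> exists x x', [/\ rel_ball v r.+1 x, col x = c,
  rel_ball v r.+1 x', col x' = c' & rel_edge x x'].
Proof.
case/set0Pn => w; rewrite finset.in_setI.
rewrite !finset.inE => /andP[/asboolP[x [vx xc [y xy yw]]] /asboolP[x' [vx' xc' [y' xy' yw']]]].
exists x, x'; split=> //; exists y; split=> //.
by rewrite (col_nbhd vx vx' xy xy') // yw.
Qed.

(** Replays the process: each step inserts the unique clause of the ball that fires, or an empty
    level. Indices agree with [ptr] only on variables of inner clauses; the others may be resampled
    from outside. *)
Lemma local_log t : exists L, [/\ log_wf inner vars bad rnd L, size L = t,
  forall x, rel_ball v r.+1 x -> occ L (col x) = runs t x,
  forall c, (forall x, rel_ball v r.+1 x -> col x <> c) -> occ L c = 0 &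
  forall x y, rel_ball v r x -> edge x y -> reads vars L t (col y) = ptr t y].
Proof.
elim: t => [|t [L [wf sL occL occ0 readsL]]].
  exists [::]; split=> //=.
  - by split=> // i; rewrite !nth_nil finset.sub0set.
  - by move=> x _; rewrite /runs big_ord0 /occ big_nil.
  - by move=> c _; rewrite /occ big_nil.
  - by move=> x y _ _; rewrite /reads big_geq.
have step x : rel_ball v r x -> rel_ball v r.+1 x by apply: rel_ball_le.
have rb x0 x y : rel_ball v r x0 -> edge x0 y -> edge x y -> rel_ball v r.+1 x.
  by move=> vx0 x0y xy; apply: rel_ball_edge vx0 _; exists y.
have [[x vx fx]|nofire] := pselect (exists2 x, rel_ball v r.+1 x & fires t x); last first.
  have [wf' occ' reads'] := log_rcons0 wf.
  exists (rcons L finset.set0); split=> //; first by rewrite size_rcons sL.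
  - move=> x vx; rewrite occ' runsS occL //; case: asboolP => [fx|]; last by rewrite addn0.
    by case: nofire; exists x.
  - by move=> c hc; rewrite occ' occ0.
  - move=> x y vx xy; have := reads' (col y); rewrite size_rcons sL => -> /=.
    rewrite (readsL x) //; case: asboolP => [[x' x'y fx']|]; last by rewrite addn0.
    by case: nofire; exists x' => //; apply: rb vx xy x'y.
have fires_uniq x' : rel_ball v r.+1 x' -> fires t x' -> x' = x.
  move=> vx' [c' _]; apply: col_ball => //; apply: ord_inj.
  by rewrite c'; case: fx.
have [|xP|L' [wf' sL' occ' reads']] := log_insert depends_on_bad wf (c := col x).
(* An isolated vertex satisfies its rule, so a firing clause has at least one variable. *)
- apply/set0Pn; have [y xy] : exists y, edge x y.
    apply: contrapT => h; case: fx => _; apply; apply: Rl_isolated => y xy.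
    by apply: h; exists y.
  by exists (col y); apply/(vars_col _ vx); exists y.
- apply/(bad_col _ vx); case: fx => _; congr (~ Rl _); apply/funext => -[y xy].
  rewrite ffunE sL (readsL x) //.
  by move: xP; rewrite inE => /asboolP[x' vx' /col_ball <- //]; apply: step.
exists L'; split=> //; first by rewrite sL' sL.
- move=> x' vx'; rewrite occ' occL // runsS; congr (_ + nat_of_bool _).
  apply/eqP/asboolP => [/col_ball -> //|/fires_uniq -> //].
- move=> c hc; rewrite occ' occ0 //; case: eqP => // E.
  by case: (hc x).
- move=> x0 y vx0 x0y; have := reads' (col y); rewrite sL' sL => -> /=.
  rewrite (readsL x0) //; congr (_ + nat_of_bool _).
  apply/idP/asboolP => [/(vars_col _ vx)[y' xy' yy']|[x' x'y fx']].
    exists x => //; suff -> : y = y' by [].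
    by apply: (col_nbhd (step _ vx0) vx) => //.
  have vx' := rb _ _ _ vx0 x0y x'y.
  by rewrite -(fires_uniq _ vx' fx'); apply/(vars_col _ vx'); exists y.
Qed.
End Local.
End Process.

(** * Heavy balls *)

Local Open Scope card_scope.

Lemma card_eq_ncard T (A : set T) k : A #= `I_k -> ncard A = k.
Proof.
move=> Ak; rewrite /ncard; case: xgetP => [m _ /= Am|/(_ k)]; last by [].
by apply/card_eq_II; apply: card_eq_trans Ak; rewrite card_eq_sym.
Qed.

Lemma card_set_finType (T : finType) (C : {set T}) : [set` C] #= `I_#|C|.
Proof.
rewrite -card_finset; have -> : [set` C] = [set` [fset x in C]%fset].
  by apply/seteqP; split=> x /=; rewrite inE.
exact/card_eq_fsetP.
Qed.

Lemma card_finset_image (X : choiceType) (T : finType) (f : X -> T) (A : set X) (C : {set T}) k :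
  A #= `I_k -> (forall c, c \in C -> exists2 x, A x & f x = c) -> #|C| <= k.
Proof.
move=> Ak hC; have fA : finite_set A by apply/finite_setP; exists k.
rewrite -(card_fset_set Ak) cardE.
rewrite -(size_map f (fset_set A)); apply: uniq_leq_size; first exact: enum_uniq.
move=> c; rewrite mem_enum => /hC[x Ax <-]; apply: map_f.
by rewrite in_fset_set // inE.
Qed.

(** * Density of the forbidden assignments *)

Section Density.
Context (Omega : choiceType) (U : nat -> set Omega) (gam : nat -> Omega -> Omega).
Local Notation edge := (edge U gam).
Variables (b : nat) (Rl : forall x, set ({y : Omega | edge x y} -> 'I_b)).
Hypothesis nbhd_fin : forall x, finite_set (nbhd U gam x).

Section Vertex.
Variable x : Omega.
Let F := fset_set (nbhd U gam x).

Let edge_mem y : edge x y -> y \in F.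
Proof. by move=> xy; rewrite in_fset_set // inE. Qed.

Let mem_edge (a : F) : edge x (val a).
Proof. by have := valP a; rewrite in_fset_set // inE. Qed.

Let unpack (u : {ffun F -> 'I_b}) (y : {y | edge x y}) := u [` edge_mem (svalP y)]%fset.

Let B : {set {ffun F -> 'I_b}} := finset (fun u : {ffun F -> 'I_b} => `[< ~ Rl (unpack u) >]).

Let card_F : #|{: F}| = deg U gam x.
Proof. by rewrite /deg ncardE // -cardfE. Qed.

Let ncardB : ncard (@Rl x) = #|finset.setC B|.
Proof.
apply: card_eq_ncard; rewrite (_ : @Rl x = unpack @` [set` finset.setC B]).
  apply: card_eq_trans (card_set_finType _); apply: inj_card_eq => u w _ _ uw.
  apply/ffunP => a; have := congr1 (fun h => h (exist _ (val a) (mem_edge a))) uw.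
  rewrite /unpack /=; set e := edge_mem _.
  by have -> : [` e]%fset = a by apply: val_inj.
apply/seteqP; split=> [g Rg|g [u]]; last by rewrite /= !finset.inE => /asboolPn /contrapT ? <-.
pose u := [ffun a : F => g (exist _ (val a) (mem_edge a))].
have gu : unpack u = g.
  apply/funext => -[y xy]; rewrite /unpack ffunE; congr g; exact: eq_exist.
by exists u => //; rewrite /= !finset.inE; apply/asboolPn => h; apply: h; rewrite gu.
Qed.

Lemma ncard_rule_le : ncard (@Rl x) <= b ^ deg U gam x.
Proof. by rewrite ncardB -card_F -[b in b ^ _]card_ord -card_ffun max_card. Qed.

(** As [col] is injective on [N(x)], the violating colour assignments are the pullback of the
    functions on [N(x)] outside [Rl x], with the same density. *)
Lemma card_violating (R : realFieldType) (V : finType) (col : Omega -> V)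
    (bd : {set {ffun V -> 'I_b}}) :
  (forall y z, edge x y -> edge x z -> col y = col z -> y = z) -> 0 < b ->
  (forall g : {ffun V -> 'I_b}, ~ Rl (fun y : {y | edge x y} => g (col (sval y))) <-> g \in bd) ->
  (#|bd|%:R = (1 - (ncard (@Rl x))%:R / b%:R ^+ deg U gam x)
             * #|{: {ffun V -> 'I_b}}|%:R :> R)%R.
Proof.
move=> ci b0 hbd; pose h (a : F) := col (val a).
have hI : injective h by move=> a a' /ci E; apply/val_inj/E; apply: mem_edge.
have := card_pullback B hI; rewrite (_ : finset _ = bd); last first.
  apply/setP => g; apply/idP/idP; rewrite !finset.inE.
    move/asboolP => H; apply/hbd; congr (~ Rl _): H; apply/funext => -[y xy].
    by rewrite /unpack ffunE.
  move/hbd => H; apply/asboolP; congr (~ Rl _): H; apply/funext => -[y xy].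
  by rewrite /unpack ffunE.
rewrite card_ffun card_ord card_F => E.
have bk : (b%:R ^+ deg U gam x != 0 :> R)%R by rewrite expf_neq0 // pnatr_eq0 -lt0n.
apply: (mulIf bk); rewrite -natrX -natrM E mulrAC natrM; congr (_ * _)%R.
have : #|B| + ncard (@Rl x) = b ^ deg U gam x.
  by rewrite ncardB cardsC card_ffun card_ord card_F.
move=> Ec; rewrite mulrBl mul1r natrX divfK // -natrX -Ec natrD addrK.
by [].
Qed.
End Vertex.
End Density.

(** Otherwise [S] would grow by a factor of at least [1 + 1/N] at each of the [R0] steps and exceed
    [k * n]. *)
Lemma slow_step (R : realFieldType) (S : nat -> nat) N R0 k n :
  0 < N -> S 0 = k -> S R0 <= k * n -> 0 < k ->
  (n%:R < (1 + N%:R^-1) ^+ R0 :> R)%R ->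
  exists2 r, r < R0 & N * (S r.+1 - S r) <= S r.
Proof.
move=> N0 S0 SR k0 hn; apply: contrapT => H.
have N0' : (0 < N%:R :> R)%R by rewrite ltr0n.
have grow r : r <= R0 -> (k%:R * (1 + N%:R^-1) ^+ r <= (S r)%:R :> R)%R.
  elim: r => [|r IH] rR; first by rewrite expr0 mulr1 S0.
  have hr : S r < N * (S r.+1 - S r) by rewrite ltnNge; apply/negP => h; apply: H; exists r.
  have h1 : S r + N * S r <= N * S r.+1 by nia.
  rewrite exprS mulrCA -(ler_pM2l N0') [leLHS]mulrA.
   rewrite (_ : N%:R * (1 + N%:R^-1) = N%:R + 1 :> R)%R; last first.
    by rewrite mulrDr mulr1 mulfV ?gt_eqF.
  apply: (@le_trans _ _ ((N%:R + 1) * (S r)%:R)%R).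
    by rewrite ler_wpM2l ?addr_ge0 // IH // ltnW.
  by rewrite mulrDl mul1r -!natrM -natrD ler_nat addnC.
have := grow R0 (leqnn _); apply/negP; rewrite -ltNge.
apply: (@le_lt_trans _ _ (k%:R * n%:R)%R); first by rewrite -natrM ler_nat.
by rewrite ltr_pM2l ?ltr0n.
Qed.

Lemma card_cover (T I : finType) (P : pred I) (B : I -> {set T}) :
  (forall t, exists2 i, P i & t \in B i) -> #|T| <= \sum_(i | P i) #|B i|.
Proof.
move=> cov; rewrite -cardsT (_ : finset.setTfor T = \bigcup_(i | P i) B i)%SET.
  apply: (big_ind2 (fun (A : {set T}) k => #|A| <= k)) => // [|A1 k1 A2 k2 h1 h2].
    by rewrite cards0.
  by apply: leq_trans (leq_card_setU _ _) _; apply: leq_add.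
by apply/esym/eqP; rewrite -finset.subTset; apply/fintype.subsetP => t _;
  have [i Pi ti] := cov t; apply/bigcupP; exists i.
Qed.

(** Brings logs stopped at different times to a common length, so that they lie in one list. *)
Lemma log_pad (V K : finType) m k N (P : {set V}) vars bad
    (rnd : {ffun V * 'I_m.+1 -> K}) L :
  log_wf P vars bad rnd L -> admissible m k N P vars L -> forall j, exists L',
  [/\ log_wf P vars bad rnd L', size L' = size L + j & admissible m k N P vars L'].
Proof.
move=> wf adm; elim=> [|j [L' [wf' sL' adm']]]; first by exists L; rewrite addn0.
have [wf2 occ2 reads2] := log_rcons0 wf'.
exists (rcons L' finset.set0); split=> //; first by rewrite size_rcons sL' addnS.
have [_ ind _] := wf2; move: adm'; rewrite /admissible ind /= => /and4P[_ h1 h2 h3].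
rewrite !inner_size_occ !outer_size_occ in h2 h3 *.
have E (Q : {set V}) :
    \sum_(c in Q) occ (rcons L' finset.set0) c = \sum_(c in Q) occ L' c.
  exact: eq_bigr.
rewrite !E h2 h3 !andbT.
by apply/fintype.forallP => y; rewrite reads2; apply: (fintype.forallP h1).
Qed.

Section Heavy.
Context (Omega : choiceType) (U : nat -> set Omega) (gam : nat -> Omega -> Omega).
Local Notation edge := (edge U gam).
Local Notation rel_ball := (rel_ball U gam).
Variables (b n : nat) (Rl : forall x, set ({y : Omega | edge x y} -> 'I_b)).
Variable col : Omega -> 'I_n.+1.
Hypothesis edge_sym : symmetric_graph U gam.
Hypothesis Rl_isolated : forall x (f : {y | edge x y} -> 'I_b),
  (forall y, ~ edge x y) -> Rl f.
Variables (Delta R0 : nat).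
Hypothesis rel_deg : forall x, exists2 j, rel_nbhd U gam x #= `I_j & j <= Delta.
Hypothesis col_inj : forall x y, rel_ball x (2 * R0 + 3) y -> col x = col y -> x = y.
Hypothesis nbhd_fin : forall x, finite_set (nbhd U gam x).

Let col_inj_le r : r <= R0 -> forall x y, rel_ball x (2 * r + 3) y -> col x = col y -> x = y.
Proof. by move=> rR x y xy; apply: col_inj; apply: rel_ball_le xy; lia. Qed.

(** Adjacent names come from [Rel(G)]-neighbours of the vertex named [c]; a name absent from the
    ball has none. *)
Lemma card_adj_vars v r c : r <= R0 ->
  #|finset (fun c' => adj (vars U gam col v r) c c')| <= Delta.
Proof.
move=> rR; have ci := col_inj_le rR.
have [[x [vx xc]]|no] := pselect (exists x, rel_ball v r.+1 x /\ col x = c).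
  have [j xj jD] := rel_deg x; apply: leq_trans jD.
  apply: (card_finset_image (f := col) xj) => c'; rewrite finset.inE => ac.
  have [x0 [x' [vx0 x0c vx' x'c xx']]] := adj_vars edge_sym ci ac.
  exists x' => //; rewrite (_ : x = x0) //.
  by apply: (col_ball ci vx vx0); rewrite xc.
rewrite eq_card0 // => c'; rewrite finset.inE; case: (boolP (adj _ _ _)) => // ac; exfalso.
have [x0 [x' [vx0 x0c _ _ _]]] := adj_vars edge_sym ci ac.
by apply: no; exists x0.
Qed.

Lemma card_bad (R : realFieldType) (p : R) v r : r <= R0 -> 0 < b -> (0 <= p)%R ->
  (forall x, 1 - (ncard (@Rl x))%:R / b%:R ^+ deg U gam x <= p)%R -> forall c,
  (#|bad Rl col v r c|%:R <= p * #|{: {ffun 'I_n.+1 -> 'I_b}}|%:R)%R.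
Proof.
move=> rR b0 p0 hp c; have ci := col_inj_le rR.
have [[x [vx <-]]|no] := pselect (exists x, rel_ball v r.+1 x /\ col x = c).
  rewrite (@card_violating _ _ _ _ Rl nbhd_fin x R _ col) ?ler_wpM2r //.
    by move=> y z xy xz; apply: (col_nbhd edge_sym ci vx vx).
  by move=> g; apply: bad_col.
rewrite eq_card0 ?mulr_ge0 // => g; rewrite finset.inE; apply/asboolPn => -[x [vx xc _]].
by apply: no; exists x.
Qed.

Variables (N k : nat) (R : realFieldType).
Hypotheses (N_gt0 : 0 < N) (k_gt0 : 0 < k).
Hypothesis growth : forall v, exists2 j, rel_ball v R0 #= `I_j &
  (j%:R < (1 + N%:R^-1) ^+ R0 :> R)%R.

(** [slow_step] is applied to the number of resamplings in balls around [v]: it starts at [k], and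
    at radius [R0] it is at most [k] times the size of the ball. *)
Lemma heavy_log m (rnd : {ffun 'I_n.+1 * 'I_m.+1 -> 'I_b}) t v :
  Delta * k <= m -> runs Rl col rnd t v = k -> (forall x, runs Rl col rnd t x <= k) ->
  exists2 r, r < R0 & exists L,
    [/\ log_wf (inner U gam col v r) (vars U gam col v r) (bad Rl col v r) rnd L,
        size L = t &
        admissible m k N (inner U gam col v r) (vars U gam col v r) L].
Proof.
move=> Dm vk xk.
(* The log at the largest radius supplies only the counts [w], so that [r] can be chosen before the
   final log is built. *)
have [L0 [_ _ occ0 occ00 _]] := local_log rnd edge_sym Rl_isolated v (col_inj_le (leqnn R0)) t.
pose w := occ L0; pose P r := inner U gam col v r.
have inP r c : reflect (exists2 x, rel_ball v r x & col x = c) (c \in P r).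
  by rewrite finset.inE; apply: asboolP.
pose S r := \sum_(c in P r) w c.
have wk c : w c <= k.
  have [[x [vx <-]]|no] := pselect (exists x, rel_ball v R0.+1 x /\ col x = c).
    by rewrite /w occ0.
  by rewrite /w occ00 // => x vx xc; apply: no; exists x.
have S0 : S 0 = k.
  rewrite /S (_ : P 0 = finset.set1 (col v)) ?finset.big_set1 ?/w ?occ0 //.
    exact: rel_ball_self.
  apply/setP => c; rewrite finset.in_set1; apply/inP/eqP.
    by case=> x [j]; rewrite leqn0 => /eqP -> /= <-.
  by move=> ->; exists v => //; apply: rel_ball_self.
have Pmono r r' : r <= r' -> P r \subset P r'.
  move=> rr; apply/fintype.subsetP => c /inP[x vx xc]; apply/inP; exists x => //.
  exact: rel_ball_le vx.
have [j vj jlt] := growth v.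
have SR : S R0 <= k * j.
  apply: (@leq_trans (\sum_(c in P R0) k)); first exact: leq_sum.
  rewrite sum_nat_const mulnC leq_mul2l; apply/orP; right.
  by apply: (card_finset_image (f := col) vj) => c /inP.
have [r rR hr] := slow_step N_gt0 S0 SR k_gt0 jlt.
exists r => //; have ci := col_inj_le (ltnW rR).
have [L [wf sL occL occL0 readsL]] := local_log rnd edge_sym Rl_isolated v ci t.
have occw c : c \in P r.+1 -> occ L c = w c.
  move=> /inP[x vx <-]; rewrite occL // /w occ0 //.
  by apply: rel_ball_le vx; rewrite ltnS ltnW.
have occLk c : occ L c <= k.
  have [[x [vx <-]]|no] := pselect (exists x, rel_ball v r.+1 x /\ col x = c).
    by rewrite occL.
  by rewrite occL0 // => x vx xc; apply: no; exists x.
have inS : inner_size (P r) L = S r.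
  rewrite inner_size_occ; apply: eq_bigr => c cP; apply: occw.
  by apply: (fintype.subsetP (Pmono r r.+1 _)).
have outS : outer_size (P r) L <= S r.+1 - S r.
  have -> : S r.+1 = S r + \sum_(c in finset.setD (P r.+1) (P r)) w c.
    rewrite /S (bigID (fun c => c \in P r)) /=; congr addn; apply: eq_bigl => c.
      apply/andP/idP => [[]//|cP]; split=> //.
      by apply: (fintype.subsetP (Pmono r r.+1 _)).
    by rewrite finset.in_setD andbC.
  rewrite addKn outer_size_occ (bigID (fun c => c \in P r.+1)) /=.
  rewrite [X in _ + X]big1 ?addn0.
    rewrite (eq_bigl (fun c => c \in finset.setD (P r.+1) (P r))).
      by apply: leq_sum => c; rewrite finset.in_setD => /andP[_ cP]; rewrite occw.
    by move=> c; rewrite finset.in_setD finset.in_setC.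
  move=> c /andP[_ /inP no]; apply: occL0 => x vx xc; apply: no; by exists x.
exists L; split=> //; rewrite /admissible.
have [_ -> _] := wf; rewrite -/(P r) inS /=; apply/and3P; split.
(* All clauses containing [y] are adjacent to one of them, so there are at most [Delta], each
   resampled at most [k] times. *)
- apply/fintype.forallP => y; apply: leq_trans Dm; rewrite reads_occ.
  have [c0 yc0|no] := pickP (fun c => y \in vars U gam col v r c); last first.
    by rewrite big_pred0.
  apply: (@leq_trans (\sum_(c | y \in vars U gam col v r c) k)); first exact: leq_sum.
  rewrite sum_nat_const leq_mul2r; apply/orP; right.
  apply: leq_trans (card_adj_vars v c0 (ltnW rR)).
  apply/fintype.subset_leq_card/fintype.subsetP => c yc; rewrite finset.inE.
  by apply/set0Pn; exists y; rewrite finset.in_setI yc0.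
- rewrite -S0 /S; apply: (leq_trans (n := \sum_(c in P r | c \in P 0) w c)).
    apply: eq_leq; apply: eq_bigl => c; rewrite andbC.
    by apply/idP/andP => [cP|[]//]; split=> //; apply: (fintype.subsetP (Pmono 0 r _)).
  by rewrite [leqRHS](bigID (fun c => c \in P 0)) /= leq_addr.
- by apply: leq_trans hr; rewrite leq_mul2l outS orbT.
Qed.

Hypothesis b_gt0 : 0 < b.
Variables p q w rho : R.
Hypotheses (p_ge0 : (0 <= p)%R) (q_ge0 : (0 <= q)%R) (w_ge0 : (0 <= w)%R).
Hypotheses (rho_ge0 : (0 <= rho)%R) (rho_le1 : (rho <= 1)%R).
Hypothesis q_w : (q * (1 + w) ^+ Delta <= w)%R.
Hypothesis p_q : forall a a', N * a' <= a -> (p ^+ a <= rho ^+ a * q ^+ (a + a'))%R.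
Hypothesis dens : forall x, (1 - (ncard (@Rl x))%:R / b%:R ^+ deg U gam x <= p)%R.

(* Everything the process can observe inside one ball: inner clauses, scopes and
   forbidden assignments; there are finitely many possibilities, whatever [k] is. *)
Definition local_type : finType :=
  ({set 'I_n.+1} * {ffun 'I_n.+1 -> {set 'I_n.+1}} *
   {ffun 'I_n.+1 -> {set {ffun 'I_n.+1 -> 'I_b}}})%type.

Hypothesis k_large : (#|local_type|%:R * (rho ^+ k * (1 + w) ^+ n.+1) < 1 :> R)%R.

Lemma good_table : exists rnd : {ffun 'I_n.+1 * 'I_(Delta * k).+1 -> 'I_b},
  forall t x, runs Rl col rnd t x < k.
Proof.
set m := Delta * k; apply: contrapT => H.
have {}H (rnd : {ffun 'I_n.+1 * 'I_m.+1 -> 'I_b}) : exists t,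
    (exists x, runs Rl col rnd t x = k) /\ forall x, runs Rl col rnd t x <= k.
  (* Stop at the first time some count reaches [k]: a step raises each count by at most one, so no
     count exceeds [k] then. *)
  have ex : exists t, `[< exists x, k <= runs Rl col rnd t x >].
    apply: contrapT => h; apply: H; exists rnd => t x; rewrite ltnNge; apply/negP => h'.
    by apply: h; exists t; apply/asboolP; exists x.
  case: (ex_minnP ex) => t /asboolP[x hx] mint; exists t.
  have le_k y : runs Rl col rnd t y <= k.
    case: t mint {hx} => [|t] mint; first by rewrite /runs big_ord0.
    rewrite runsS; apply: (@leq_trans (runs Rl col rnd t y).+1).
      by rewrite -addn1 leq_add2l leq_b1.
    rewrite ltnNge; apply/negP => h.
    have : t.+1 <= t by apply: mint; apply/asboolP; exists y.
    by rewrite ltnn.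
  by split=> //; exists x; apply/eqP; rewrite eqn_leq le_k.
(* There are finitely many tables, so the stopping times have a maximum [M]. *)
have [T hT] := choice H; pose M := \max_rnd T rnd.
pose good (u : local_type) := [/\ forall c, depends_on (u.1.2 c) (u.2 c),
  forall c, (#|u.2 c|%:R <= p * #|{: {ffun 'I_n.+1 -> 'I_b}}|%:R)%R &
  forall c, #|finset (fun c' => adj u.1.2 c c')| <= Delta].
pose heavy (u : local_type) := finset (fun rnd : {ffun 'I_n.+1 * 'I_m.+1 -> 'I_b} =>
  has (fun L => admissible m k N u.1.1 u.1.2 L && consistent u.1.1 u.1.2 u.2 rnd L)
    (logs u.1.2 M (finset.setTfor _))).
have cover rnd : exists2 u, `[< good u >] & rnd \in heavy u.
  have [[v vk] le_k] := hT rnd.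
  have [r rR [L0 [wf0 sL0 adm0]]] := heavy_log (leqnn _) vk le_k.
  have [L [wf sL adm]] := log_pad wf0 adm0 (M - size L0).
  exists (inner U gam col v r, [ffun c => vars U gam col v r c], [ffun c => bad Rl col v r c]).
    apply/asboolP; rewrite /good /=; have ci := col_inj_le (ltnW rR).
    have -> : ([ffun c => vars U gam col v r c] : 'I_n.+1 -> _) = vars U gam col v r.
      by apply/funext => c; rewrite ffunE.
    split=> c; rewrite ?ffunE; first exact: depends_on_bad.
      by apply: card_bad => //; apply: ltnW.
    by apply: card_adj_vars; apply: ltnW.
  rewrite finset.inE /=.
  have -> : ([ffun c => vars U gam col v r c] : 'I_n.+1 -> _) = vars U gam col v r.
    by apply/funext => c; rewrite ffunE.
  have -> : ([ffun c => bad Rl col v r c] : 'I_n.+1 -> _) = bad Rl col v r.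
    by apply/funext => c; rewrite ffunE.
  have [hch _ hcons] := wf; apply/hasP; exists L; last by rewrite adm hcons.
  apply: mem_logs; last by apply: chained_nth => //; apply: finset.subsetT.
  by rewrite sL subnKC // sL0 /M; apply: (leq_bigmax rnd).
set F := #|{: {ffun 'I_n.+1 * 'I_m.+1 -> 'I_b}}|.
have F_gt0 : (0 < F%:R :> R)%R.
  by rewrite ltr0n /F card_ffun expn_gt0 card_ord b_gt0.
have := ltr_pM2r F_gt0 (#|local_type|%:R * (rho ^+ k * (1 + w) ^+ n.+1))%R 1%R.
rewrite k_large mul1r; apply/negP; rewrite -leNgt.
apply: (@le_trans _ _ (\sum_(u : local_type | `[< good u >]) #|heavy u|%:R)%R).
  rewrite -natr_sum ler_nat; exact: card_cover.
apply: (@le_trans _ _ (\sum_(u : local_type) (rho ^+ k * (1 + w) ^+ n.+1 * F%:R))%R).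
  rewrite [leRHS](bigID (fun u : local_type => `[< good u >])) /=.
  rewrite -[leLHS]addr0; apply: lerD; last first.
    by apply: sumr_ge0 => u _; rewrite !mulr_ge0 ?exprn_ge0 ?addr_ge0.
  apply: ler_sum => u /asboolP[g1 g2 g3].
  have := card_has_log (R := R) m k u.1.1 _ g1 p_ge0 g2 q_ge0 w_ge0 rho_ge0 rho_le1 q_w g3 p_q M.
  by rewrite !card_ord; apply; rewrite b_gt0.
by rewrite sumr_const -[leLHS]mulr_natl [leLHS]mulrA.
Qed.
End Heavy.

(** * The limit assignment *)

Lemma finite_set_bound (T : choiceType) (F : set T) (h : T -> nat) : finite_set F ->
  exists M, forall y, F y -> h y <= M.
Proof.
move=> /finite_seqP[s ->]; elim: s => [|a s [M hM]]; first by exists 0.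
exists (maxn (h a) M) => y; rewrite /= inE leq_max => /orP[/eqP ->|/hM ->].
  by rewrite leqnn.
by rewrite orbT.
Qed.

Section Limit.
Context d (Omega : measurableType d) (U : nat -> set Omega) (gam : nat -> Omega -> Omega).
Local Notation edge := (edge U gam).
Hypothesis arrows : borel_arrows U gam.
Variable A : nat -> set Omega.
Hypotheses (A_meas : forall n, measurable (A n)) (A_sep : separates_finite A).
Hypothesis edge_sym : symmetric_graph U gam.
Variables (b n m k Delta : nat) (Rl : forall x, set ({y : Omega | edge x y} -> 'I_b)).
Hypothesis nbhd_fin : forall x, finite_set (nbhd U gam x).
Hypothesis deg_le : forall x, deg U gam x <= Delta.
Hypothesis Rl_borel : borel_local_rule Rl.
Variable col : Omega -> 'I_n.+1.
Hypothesis col_meas : forall c, measurable (col @^-1` [set c]).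
Variable rnd : {ffun 'I_n.+1 * 'I_m.+1 -> 'I_b}.
Hypothesis runs_lt : forall t x, runs Rl col rnd t x < k.

Let guess_meas (f : Omega -> nat) : (forall j, measurable [set y | f y = j]) ->
  forall a, measurable (guess col rnd f @^-1` [set a]).
Proof.
move=> mf a; pose G (u : 'I_n.+1 * nat) :=
  if rnd (u.1, inord u.2) == a then col @^-1` [set u.1] `&` [set y | f y = u.2] else set0.
rewrite (_ : _ @^-1` _ = \bigcup_u G u).
  apply: countable_bigcupT_measurable => [|u]; first exact: countableP.
  by rewrite /G; case: ifP => // _; apply: measurableI.
apply/seteqP; split=> y; first by move=> /eqP ya; exists (col y, f y) => //; rewrite /G ya.
by move=> [[c j] _]; rewrite /G /=; case: eqP => // <- [/= <- <-].
Qed.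

Let ptr_meas t j : measurable [set y | ptr Rl col rnd t y = j].
Proof.
elim: t j => [|t IH] j /=.
  have [->|j0] := eqVneq j 0; first by rewrite (_ : [set _ | _] = setT) //; apply/seteqP.
  rewrite (_ : [set _ | _] = set0) //; apply/seteqP; split=> // y /= /esym/eqP.
  by rewrite (negPf j0).
pose F := [set x | fires Rl col rnd t x].
have mF : measurable F.
  rewrite (_ : F = col @^-1` [set inord (t %% n.+1)] `\`
    [set x | @Rl x (fun y => guess col rnd (ptr Rl col rnd t) (sval y))]).
    apply: measurableD => //; apply: (rule_measurable arrows A_meas A_sep nbhd_fin deg_le) => //.
    exact: guess_meas.
  by apply/seteqP; split=> x /= [h1 h2]; split=> //;
    [apply: ord_inj; rewrite h1 inordK ?ltn_mod|rewrite h1 inordK ?ltn_mod].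
have mP := rel_preim_edge_measurable arrows mF.
rewrite (_ : [set y | _] =
  ([set y | ptr Rl col rnd t y = j] `\` rel_preim edge F) `|`
  ([set y | (ptr Rl col rnd t y).+1 = j] `&` rel_preim edge F)).
  apply: measurableU; first exact: measurableD.
  apply: measurableI => //; case: j => [|j].
    by rewrite (_ : [set y | _] = set0) //; apply/seteqP; split.
  rewrite (_ : [set y | _] = [set y | ptr Rl col rnd t y = j]) //.
  by apply/seteqP; split=> y /=; [case|move=> ->].
have E y : ptr Rl col rnd t.+1 y = ptr Rl col rnd t y + `[< rel_preim edge F y >].
  by congr (_ + nat_of_bool _); apply: asbool_equiv_eq; split=> -[x xy fx]; exists x => //;
    apply/edge_sym.
apply/seteqP; split=> y /=; rewrite -/(ptr Rl col rnd t.+1 y) E; case: asboolP => h;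
  rewrite ?addn0 ?addn1.
- by right.
- by left.
- by case=> -[].
- by case=> -[].
Qed.

(** [runs] is bounded by [k], and after it attains its maximum at [x] a further firing would raise
    it. *)
Let stops x : exists T, forall t, T <= t -> ~ fires Rl col rnd t x.
Proof.
pose P j := `[< exists t, runs Rl col rnd t x = j >].
have exP : exists j, P j by exists (runs Rl col rnd 0 x); apply/asboolP; exists 0.
have leP j : P j -> j <= k by move=> /asboolP[t <-]; apply: ltnW.
case: (ex_maxnP exP leP) => j /asboolP[T Tj] maxj; exists T => t Tt ft.
have := maxj (runs Rl col rnd t.+1 x) (asboolT (ex_intro _ t.+1 erefl)).
by rewrite runsS (asboolT ft) addn1 -Tj ltnNge runs_mono.
Qed.

Lemma process_limit : exists f : Omega -> 'I_b,
  (forall a, measurable (f @^-1` [set a])) /\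
  forall x, Rl (fun y : {y | edge x y} => f (sval y)).
Proof.
have [T hT] := choice stops.
have settle y : exists S, forall t, S <= t -> ptr Rl col rnd t y = ptr Rl col rnd S y.
  have [S hS] := finite_set_bound T (nbhd_fin y); exists S => t /subnKC <-.
  elim: (t - S) => [|i IH]; first by rewrite addn0.
  rewrite addnS /= IH; case: asboolP => [[x xy fx]|]; last by rewrite addn0.
  exfalso; apply: (hT x (S + i)) => //; apply: leq_trans (leq_addr _ _).
  by apply: hS; apply/edge_sym.
have [S hS] := choice settle.
pose g t := guess col rnd (ptr Rl col rnd t).
pose f y := g (S y) y.
have gf y t : S y <= t -> g t y = f y by move=> St; rewrite /f /g /guess hS.
exists f; split=> [a|x].
  (* A point has limit value [a] iff its guess equals [a] from some time on. *)
  rewrite (_ : f @^-1` _ = \bigcup_s \bigcap_(t in [set t | s <= t]) (g t @^-1` [set a])).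
    apply: bigcupT_measurable => s; apply: bigcap_measurableType => // t _.
    exact/guess_meas/ptr_meas.
  apply/seteqP; split=> y /=; first by move=> ya; exists (S y) => // t /= /gf ->.
  by move=> [s _ hs]; rewrite -(gf y (maxn s (S y))) ?leq_maxr //; apply: hs; rewrite /= leq_maxl.
apply: contrapT => nR; have [M hM] := finite_set_bound S (nbhd_fin x).
(* A time at which it is the turn of the colour of [x], late enough that [x] has stopped firing and
   its neighbours have settled. *)
pose t := maxn M (T x) * n.+1 + col x.
have Mt : maxn M (T x) <= t by rewrite (leq_trans _ (leq_addr _ _)) // leq_pmulr.
apply: (hT x t); first by apply: leq_trans Mt; rewrite leq_maxr.
split; first by rewrite /t modnMDl modn_small.
move=> R; apply: nR; congr (Rl _): R; apply/funext => -[y xy] /=.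
by apply: gf; apply: leq_trans Mt; rewrite leq_max hM.
Qed.
End Limit.

(** * Numerical constants *)

Section Constants.
Variable R : realType.
Local Open Scope ring_scope.

(** Bernoulli's inequality for powers of [z^-1]. *)
Lemma expr_lt_eps (z e : R) : 0 <= z -> z < 1 -> 0 < e -> exists N, z ^+ N < e.
Proof.
move=> z0 z1 e0; have [->|zn0] := eqVneq z 0; first by exists 1%N; rewrite expr1.
have zp : 0 < z by rewrite lt_def zn0.
pose h := z^-1 - 1; have h0 : 0 < h by rewrite subr_gt0 invf_gt1.
have bern N : 1 + N%:R * h <= z^-1 ^+ N.
  elim: N => [|N IH]; first by rewrite mul0r addr0 expr0.
  have -> : z^-1 = 1 + h by rewrite /h addrC subrK.
  rewrite exprS; apply: le_trans (ler_wpM2l _ (_ : 1 + N%:R * h <= _)); first last.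
  - by rewrite [1 + h]addrC subrK.
  - by rewrite addr_ge0 // ltW.
  have : 0 <= N%:R * (h * h) by rewrite !mulr_ge0 // ltW.
  by rewrite -natr1; lra.
exists (Num.truncn (e^-1 / h)).+1; set N := _.+1.
have zN : 0 < z ^+ N by apply: exprn_gt0.
rewrite -ltf_pV2 ?posrE // -exprVn; apply: lt_le_trans (bern N).
have : e^-1 / h < N%:R by apply: truncnS_gt.
by rewrite ltr_pdivrMr //; lra.
Qed.

(** Choose [s'] halfway between [p / q] and [1] and write [p] as [rho * s' * q]. With [s' ^+ N < q],
    the powers of [s'] pay for the [a'] extra factors [q]. *)
Lemma exists_rate (p q : R) : 0 < p -> p < q -> q <= 1 ->
  exists (N : nat) (rho : R), [/\ (0 < N)%N, 0 <= rho, rho < 1 &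
    forall a a', (N * a' <= a)%N -> p ^+ a <= rho ^+ a * q ^+ (a + a')].
Proof.
move=> p0 pq q1; have q0 : 0 < q by apply: lt_trans pq.
pose s := p / q; pose s' := (1 + s) / 2.
have s0 : 0 < s by rewrite divr_gt0.
have s1 : s < 1 by rewrite ltr_pdivrMr // mul1r.
have s'0 : 0 < s' by rewrite /s'; lra.
have s'1 : s' < 1 by rewrite /s'; lra.
have ss' : s < s' by rewrite /s'; lra.
have [N hN] := expr_lt_eps (ltW s'0) s'1 q0.
exists N.+1, (s / s'); split=> //; first by rewrite divr_ge0 // ltW.
  by rewrite ltr_pdivrMr // mul1r.
move=> a a' Na.
have -> : p = s / s' * s' * q by rewrite divfK ?gt_eqF // divfK ?gt_eqF.
have u0 : 0 <= s / s' by rewrite divr_ge0 // ltW.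
move: (s / s') u0 => u u0; clearbody s'.
rewrite !exprMn exprD -mulrA ler_wpM2l ?exprn_ge0 //.
rewrite mulrC ler_wpM2l ?exprn_ge0 ?(ltW q0) //.
apply: (@le_trans _ _ (s' ^+ (N * a'))).
  rewrite (ler_wiXn2l (ltW s'0) (ltW s'1)) //; apply: leq_trans Na.
  by rewrite leq_mul2r leqnSn orbT.
by rewrite exprM; apply: lerXn2r; rewrite ?nnegrE ?exprn_ge0 ?(ltW s'0) ?(ltW q0) ?(ltW hN).
Qed.
End Constants.

Lemma exists_small_power (R : realType) (z C : R) : (0 <= z -> z < 1 -> 0 <= C ->
  exists2 k : nat, (0 < k)%N & C * z ^+ k < 1)%R.
Proof.
move=> z0 z1 C0; have C1 : (0 < C + 1)%R by lra.
have [|N hN] := expr_lt_eps z0 z1 (e := (C + 1)^-1%R); first by rewrite invr_gt0.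
exists N.+1 => //; have zN : (0 <= z ^+ N)%R by apply: exprn_ge0.
have : (z ^+ N * (C + 1) < 1)%R by rewrite -ltr_pdivlMr // mul1r.
have : (z * (C * z ^+ N) <= C * z ^+ N)%R by rewrite ler_piMl ?mulr_ge0 ?(ltW z1).
rewrite exprS; lra.
Qed.

(** * Measurability of balls in [Rel(G)] *)

Section WalkMeasurable.
Context d (Omega : measurableType d) (U : nat -> set Omega) (gam : nat -> Omega -> Omega).
Hypothesis arrows : borel_arrows U gam.
Hypothesis edge_sym : symmetric_graph U gam.

(** By symmetry a step of [Rel(G)] is two steps of [G], whose preimages are countable unions of
    arrow preimages. *)
Lemma rel_preim_walk_measurable k B :
  measurable B -> measurable (rel_preim (rel_walk U gam k) B).
Proof.
move=> mB; elim: k => [|k IH].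
  by rewrite (_ : rel_preim _ _ = B) //; apply/seteqP; split=> x /=; [case=> y -> |exists x].
rewrite (_ : rel_preim _ _ = rel_preim (edge U gam)
    (rel_preim (edge U gam) (rel_preim (rel_walk U gam k) B))).
  by do 2!apply: rel_preim_edge_measurable => //.
apply/seteqP; split=> x /=.
  move=> [y [u [[z [xz uz]] uy]] By]; exists z => //; exists u; first exact/edge_sym.
  by exists y.
move=> [z xz [u zu [y uy By]]]; exists y => //; exists u; split=> //.
by exists z; split=> //; apply/edge_sym.
Qed.

Lemma rel_preim_ball_measurable r B :
  measurable B -> measurable (rel_preim (fun x => rel_ball U gam x r) B).
Proof.
move=> mB; rewrite (_ : rel_preim _ _ = \bigcup_(k in [set k | k <= r])
    rel_preim (rel_walk U gam k) B).
  by apply: bigcup_measurable => k _; apply: rel_preim_walk_measurable.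
apply/seteqP; split=> x; first by move=> [y [k kr w] By]; exists k => //; exists y.
by move=> [k kr [y w By]]; exists y => //; exists k.
Qed.
End WalkMeasurable.

(** * Choice of the constants and assembly *)

Local Open Scope ring_scope.

Theorem theorem1p3 (R : realType) (b : nat) (hb : (2 <= b)%N)
  (d : measure_display) (Omega : measurableType d)
  (hstd : standard_borel R Omega)
  (U : nat -> set Omega) (gam : nat -> Omega -> Omega)
  (harrows : borel_arrows U gam)
  (hsym : symmetric_graph U gam)
  (Rl : forall x : Omega, set ({y : Omega | edge U gam x y} -> 'I_b))
  (hRl : borel_local_rule Rl)
  (hgrowth : unif_subexp_growth U gam R)
  (Delta : nat)
  (hDelta_max : (forall x, (ncard (rel_nbhd U gam x) <= Delta)%N) /\
                exists x, ncard (rel_nbhd U gam x) = Delta)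
  (hp : forall x : Omega,
     1 - (ncard (Rl x))%:R / (b%:R ^+ deg U gam x) < 1 / (expR 1 * Delta%:R :> R)) :
  exists f : Omega -> 'I_b,
    (forall k : 'I_b, measurable (f @^-1` [set k])) /\
    forall x : Omega, Rl x (fun y : {y : Omega | edge U gam x y} => f (proj1_sig y)).
Proof.
have b0 : (0 < b)%N by apply: ltnW.
have [A A_meas A_sep] := standard_borel_separates hstd.
(* Growth with [eps = 1] bounds all balls of one large radius [r1] by [2 ^ r1], and smaller balls
   are contained in these. *)
have ball_bound r : exists M, forall v, exists2 j, rel_ball U gam v r #= `I_j & (j <= M)%N.
  have [r0 hr0] := hgrowth 1 ltr01; pose r1 := (maxn r r0).+1.
  exists (2 ^ r1)%N => v; have [|j vj jlt] := hr0 r1 _ v; first by rewrite ltnS leq_maxr.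
  have sub : rel_ball U gam v r `<=` rel_ball U gam v r1.
    by move=> x; apply: rel_ball_le; rewrite ltnW // ltnS leq_maxl.
  have fin1 : finite_set (rel_ball U gam v r1) by apply/finite_setP; exists j.
  have [i vi] := (finite_setP _).1 (sub_finite_set sub fin1).
  exists i => //; rewrite -(card_fset_set vi).
  apply: (@leq_trans j); last first.
    by rewrite -(ler_nat R) ltW //; move: jlt; rewrite natrX -[2 : R]natr1.
  rewrite -(card_fset_set vj); apply: fsubset_leq_card; rewrite -fset_set_sub //.
  exact: sub_finite_set sub fin1.
have rel_fin x : finite_set (rel_nbhd U gam x).
  have [M /(_ x)[j xj _]] := ball_bound 1.
  apply: (sub_finite_set _ ((finite_setP _).2 (ex_intro _ j xj))).
  by move=> y xy; exists 1 => //; exists y.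
have rel_deg x : exists2 j, rel_nbhd U gam x #= `I_j & (j <= Delta)%N.
  have [j xj] := (finite_setP _).1 (rel_fin x); exists j => //.
  by rewrite -(card_eq_ncard xj) hDelta_max.1.
have nbhd_sub x y : edge U gam x y -> nbhd U gam x `<=` rel_nbhd U gam y.
  by move=> xy z xz; exists x; split; apply/hsym.
have nbhd_fin x : finite_set (nbhd U gam x).
  have [[y xy]|no] := pselect (exists y, edge U gam x y).
    exact: sub_finite_set (nbhd_sub x y xy) (rel_fin y).
  rewrite (_ : nbhd _ _ _ = set0) //; apply/seteqP; split=> // y xy.
  by apply: no; exists y.
have deg_le x : (deg U gam x <= Delta)%N.
  have [[y xy]|no] := pselect (exists y, edge U gam x y).
    apply: leq_trans (hDelta_max.1 y); rewrite /deg !ncardE //.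
    apply: fsubset_leq_card; rewrite -fset_set_sub //; exact: nbhd_sub.
  rewrite /deg (_ : nbhd _ _ _ = set0) ?ncardE ?fset_set0 ?cardfs0 //.
  by apply/seteqP; split=> // y xy; apply: no; exists y.
have [x0 hx0] := hDelta_max.2.
(* For [Delta = 0] the bound in [hp] is [0], since [0^-1 = 0], whereas [p(x)] is never negative. *)
have D0 : (0 < Delta)%N.
  rewrite lt0n; apply/eqP => D0; have := hp x0; rewrite D0 mulr0 invr0 mulr0 subr_lt0.
  rewrite ltr_pdivlMr ?exprn_gt0 ?ltr0n // mul1r -natrX ltr_nat ltnNge.
  by rewrite ncard_rule_le.
pose q : R := (expR 1 * Delta%:R)^-1.
have q0 : (0 < q) by rewrite invr_gt0 mulr_gt0 ?expR_gt0 ?ltr0n.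
have e1 : (1 <= expR 1 :> R) by apply: le_trans (expR_ge1Dx 1); rewrite lerDl.
have q1 : (q <= 1).
  by rewrite invf_le1 ?mulr_gt0 ?expR_gt0 ?ltr0n // mulr_ege1 // ler1n.
pose pv (u : 'I_Delta.+1 * 'I_(b ^ Delta)%N.+1) : R := (1 - (u.2)%:R / b%:R ^+ u.1).
(* Degrees are bounded, so [p(x)] takes finitely many values and a single [p < q] dominates them;
   the base value [q / 2] makes it positive. *)
pose p : R := \big[Order.max/(q / 2)]_(u | (pv u < q)) pv u.
have pq : (p < q) by apply/bigmax_ltP; split=> //; lra.
have p0 : (0 < p) by apply: lt_le_trans (bigmax_ge_id _ _ _ _); lra.
have dens x : (1 - (ncard (Rl x))%:R / b%:R ^+ deg U gam x <= p).
  pose u : 'I_Delta.+1 * 'I_(b ^ Delta)%N.+1 := (inord (deg U gam x), inord (ncard (Rl x))).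
  have hn : (ncard (Rl x) < (b ^ Delta).+1)%N.
    by rewrite ltnS; apply: leq_trans (ncard_rule_le Rl nbhd_fin x) _; rewrite leq_pexp2l.
  have pu : pv u = (1 - (ncard (Rl x))%:R / b%:R ^+ deg U gam x).
    by rewrite /pv /u /= !inordK // ltnS.
  by rewrite -pu; apply: le_bigmax_cond; rewrite pu -[q]mul1r.
(* If an isolated vertex rejected its only assignment, its violation probability would be [1], which
   is at least [q]. *)
have Rl_isolated x (f : {y | edge U gam x y} -> 'I_b) : (forall y, ~ edge U gam x y) -> Rl x f.
  move=> no; apply: contrapT => nf; have := le_lt_trans (dens x) pq.
  rewrite (@card_eq_ncard _ (Rl x) 0) ?mul0r ?subr0; first by rewrite ltNge q1.
  rewrite II0 card_eq0; apply/eqP/seteqP; split=> // g Rg; apply: nf.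
  by rewrite (_ : f = g) //; apply/funext => -[y xy]; case: (no y).
have [N [rho [N0 rho0 rho1 hrate]]] := exists_rate p0 pq q1.
pose w : R := (Delta%:R^-1).
have w0 : (0 <= w) by rewrite invr_ge0.
(* This is [(1 + 1/Delta)^Delta <= e]. *)
have qw : (q * (1 + w) ^+ Delta <= w).
  rewrite /q invfM -/w -mulrA mulrC -mulrA ler_piMr // mulrC.
  rewrite ler_pdivrMl ?expR_gt0 // mulr1.
  rewrite -[X in expR X](mulfV (x := Delta%:R)) ?pnatr_eq0 -?lt0n // expRM_natl.
  by apply: lerXn2r; rewrite ?nnegrE ?addr_ge0 ?expR_ge0 // expR_ge1Dx.
(* The rate [1/N] is the one [slow_step] contradicts; the successor is taken because growth is
   controlled only beyond [r0]. *)
have [|r0 hr0] := hgrowth (N%:R^-1); first by rewrite invr_gt0 ltr0n.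
pose R0 := r0.+1.
have growth v : exists2 j, rel_ball U gam v R0 #= `I_j & (j%:R < (1 + N%:R^-1) ^+ R0 :> R).
  exact: hr0.
have [M hM] := ball_bound (2 * R0 + 3)%N.
pose E x y := rel_ball U gam x (2 * R0 + 3)%N y.
have E_fin x : finite_set [set y | E x y].
  by have [j xj _] := hM x; apply/finite_setP; exists j.
have E_deg x : (#|` fset_set [set y | E x y]| <= M)%N.
  by have [j xj jM] := hM x; rewrite (card_fset_set xj).
have [col [col_meas col_inj]] := borel_coloring A_meas A_sep (E := E)
  (fun x y => @rel_ball_sym _ U gam x _ y) E_fin E_deg
  (@rel_preim_ball_measurable _ _ _ _ harrows hsym _).
(* [k] is chosen last: the number of local types depends on [M] and [b] but not on [k]. *)
have [|k k0 hk] := exists_small_power (C := #|local_type b M|%:R * (1 + w) ^+ M.+1) rho0 rho1.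
  by rewrite mulr_ge0 ?exprn_ge0 ?addr_ge0.
have [rnd runs_lt] : exists rnd : {ffun 'I_M.+1 * 'I_(Delta * k)%N.+1 -> 'I_b},
    forall t x, (runs Rl col rnd t x < k)%N.
  apply: (@good_table _ _ _ _ _ Rl col hsym Rl_isolated Delta R0 rel_deg col_inj nbhd_fin
    N k R N0 k0 growth b0 p q w rho (ltW p0) (ltW q0) w0 rho0 (ltW rho1) qw hrate dens).
  by rewrite [(rho ^+ k * _)]mulrC mulrA.
exact: (process_limit harrows A_meas A_sep hsym nbhd_fin deg_le hRl col_meas runs_lt).
Qed.
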